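(* Let $k$ be a field and let $r, d \geq 1$ be integers. Then there is a finite simple graph $G$ such that, with $R$ the polynomial ring over $k$ whose variables are the vertices of $G$ and $I(G) \subseteq R$ the edge ideal of $G$, one has $\operatorname{reg}(R/I(G)) = r$ and $\deg h_{R/I(G)}(t) = d$.
   Context: For a finite simple graph $G$ with vertex set $V(G) = \{x_1,\ldots,x_n\}$ and edge set $E(G)$, the edge ideal of $G$ is the ideal $I(G) = (x_ix_j \mid \{x_i,x_j\} \in E(G))$ of the polynomial ring $R = k[x_1,\ldots,x_n]$ (standard grading, each variable of degree $1$), where $k$ is a field. For a homogeneous ideal $I$ of $R$, let $\beta_{i,j}$ denote the graded Betti numbers of $R/I$, i.e. the $i$-th module in the graded minimal free resolution of $R/I$ over $R$ is $\bigoplus_j R(-j)^{\beta_{i,j}}$ (with $R$ in homological degree $0$). The (Castelnuovo-Mumford) regularity is $\operatorname{reg}(R/I) = \max\{j-i \mid \beta_{i,j} \neq 0\}$. The Hilbert series of $R/I$ is $H_{R/I}(t) = \sum_{j \geq 0} \dim_k (R/I)_j\, t^j$. It can be written uniquely in lowest terms as $H_{R/I}(t) = h_{R/I}(t)/(1-t)^{\dim(R/I)}$ with $h_{R/I}(t) \in \mathbb{Z}[t]$ and $h_{R/I}(1) \neq 0$, where $\dim(R/I)$ is the Krull dimension; the polynomial $h_{R/I}(t)$ is called the $h$-polynomial of $R/I$. *)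

(* Defs.v *)
From HB Require Import structures.
From mathcomp Require Import all_boot all_order all_algebra.
From mathcomp Require Export mpoly.

Set Implicit Arguments.
Unset Strict Implicit.
Unset Printing Implicit Defensive.

Import GRing.Theory Num.Theory.
Local Open Scope ring_scope.

Record sgraph := SGraph {
  nvert : nat;
  edge : rel 'I_nvert;
  edge_sym : ssrbool.symmetric edge;
  edge_irr : irreflexive edge }.

(* Ideals are [Prop]-valued predicates: the boolean ideals of [ring_quotient]
   would restrict the prime ideals below to decidable ones. *)

Section Ideals.
Variable R : comNzRingType.
Implicit Types (S I P Q : R -> Prop).

Definition ideal_gen S : R -> Prop := fun p =>
  exists (m : nat) (a g : 'I_m -> R),
    (forall i, S (g i)) /\ p = \sum_(i < m) a i * g i.

Definition is_ideal I : Prop :=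
  [/\ I 0, forall p q, I p -> I q -> I (p + q) & forall a p, I p -> I (a * p)].

Definition is_prime_ideal P : Prop :=
  [/\ is_ideal P, ~ P 1 & forall p q, P (p * q) -> P p \/ P q].

Definition sub_ideal P Q : Prop := forall p, P p -> Q p.

Definition proper_sub_ideal P Q : Prop :=
  sub_ideal P Q /\ exists2 p, Q p & ~ P p.

(* C 0 < C 1 < ... < C l, a chain of length l of primes of R containing I,
   i.e. of primes of R/I. *)
Definition prime_chain I (l : nat) (C : nat -> R -> Prop) : Prop :=
  (forall i, (i <= l)%N -> is_prime_ideal (C i) /\ sub_ideal I (C i))
  /\ (forall i, (i < l)%N -> proper_sub_ideal (C i) (C i.+1)).

(* D is the Krull dimension of R/I. *)
Definition is_krull_dim_quot I (D : nat) : Prop :=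
  (exists C, prime_chain I D C)
  /\ (forall l C, prime_chain I l C -> (l <= D)%N).

End Ideals.

Section Graded.
Variables (k : fieldType) (n : nat).
Local Notation R := {mpoly k[n]}.
Implicit Type I : R -> Prop.

(* F_i is the direct sum of the R(-j), j in [shift i], realised as row vectors;
   [diff i] : F_(i+1) -> F_i acts by v |-> v *m diff i. *)
Record free_cplx := FreeCplx {
  shift : nat -> seq nat;
  diff : forall i, 'M[R]_(size (shift i.+1), size (shift i)) }.

(* The differentials preserve degrees. *)
Definition graded_cplx (F : free_cplx) : Prop :=
  forall i (a : 'I_(size (shift F i.+1))) (b : 'I_(size (shift F i))),
    let s := nth 0%N (shift F i.+1) a in
    let t := nth 0%N (shift F i) b in
    diff F i a b = 0 \/ (t <= s)%N /\ diff F i a b \is (s - t).-homog.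

(* The image of each differential lies in (x_1, ..., x_n) F_i. *)
Definition minimal_cplx (F : free_cplx) : Prop :=
  forall i (a : 'I_(size (shift F i.+1))) (b : 'I_(size (shift F i))),
    (diff F i a b)@_0%MM = 0.

(* Exactness of ... -> F_2 -> F_1 -> F_0 = R -> R/I -> 0; as F_0 has rank 1,
   [const_mx p] is the element p of F_0. *)
Definition resolves_quot I (F : free_cplx) : Prop :=
  [/\ shift F 0 = [:: 0%N],
      forall p, I p <->
        exists w : 'rV[R]_(size (shift F 1)), w *m diff F 0 = const_mx p
    & forall i (v : 'rV[R]_(size (shift F i.+1))),
        v *m diff F i = 0 <->
        exists w : 'rV[R]_(size (shift F i.+2)), v = w *m diff F i.+1].

Definition is_min_graded_free_res I (F : free_cplx) : Prop :=
  [/\ graded_cplx F, minimal_cplx F & resolves_quot I F].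

(* beta i j are the graded Betti numbers of R/I. They do not depend on the
   minimal graded free resolution, which is unique up to isomorphism. *)
Definition is_betti_quot I (beta : nat -> nat -> nat) : Prop :=
  exists2 F, is_min_graded_free_res I F &
    forall i j, beta i j = count_mem j (shift F i).

(* reg(R/I) = r. *)
Definition is_reg_quot I (r : int) : Prop :=
  exists2 beta, is_betti_quot I beta &
    (exists i j : nat, beta i j <> 0%N /\ j%:Z - i%:Z = r)
    /\ (forall i j : nat, beta i j <> 0%N -> j%:Z - i%:Z <= r).

(* dim_k (R/I)_j = m: some m forms of degree j induce a k-basis of (R/I)_j. *)
Definition is_dim_quot I (j m : nat) : Prop :=
  exists b : 'I_m -> R,
    [/\ forall i, b i \is j.-homog,
        forall c : 'I_m -> k, I (\sum_(i < m) c i *: b i) -> forall i, c i = 0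
      & forall p : R, p \is j.-homog ->
          exists c : 'I_m -> k, I (p - \sum_(i < m) c i *: b i)].

Definition is_hilbert_fun_quot I (H : nat -> nat) : Prop :=
  forall j, is_dim_quot I j (H j).

(* h(t) = (1 - t)^D * (\sum_j H_j t^j) as formal power series, with D the Krull
   dimension of R/I and h(1) <> 0. *)
Definition is_h_poly_quot I (h : {poly int}) : Prop :=
  exists (H : nat -> nat) (D : nat),
    [/\ is_hilbert_fun_quot I H,
        is_krull_dim_quot I D,
        h.[1] <> 0
      & forall j : nat,
          h`_j = \sum_(i < j.+1) ((1 - 'X) ^+ D : {poly int})`_i
                                 * (H (j - i)%N)%:Z].

End Graded.

Definition edge_ideal (k : fieldType) (G : sgraph) :
    {mpoly k[nvert G]} -> Prop :=
  ideal_gen (fun p => exists i j : 'I_(nvert G), edge i j /\ p = 'X_i * 'X_j).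

Arguments edge_ideal : clear implicits.

(* Main.v *)
Require Import Defs.
From mathcomp Require Import all_boot all_order all_algebra.
From mathcomp Require Import zify ring.
From Stdlib Require Import ClassicalEpsilon.

(** Regularity and degree of the h-polynomial can be prescribed independently because
    two constructions on graphs move them differently.

    - A disjoint edge adjoins a regular quadric to the edge ideal: the regularity
      grows by 1 and h is multiplied by 1 + t ([realizes_add_edge]).
    - Joining a new vertex z to a minimum vertex cover C and to b + 1 >= 1 further new
      vertices replaces the regularity rho by max(rho, 1), which is rho as soon as there
      is an edge, and replaces h by h + t(1 - t)^b ([realizes_add_star]).

    Both raise the height of the edge ideal by 1. For d >= r, start with a star, whose
    h-polynomial 1 + t(1 - t)^(d - r) has degree d - r + 1, and add r - 1 disjoint
    edges. For d < r, first produce regularity r - d + 1 with a linear h-polynomial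
    ([realizable_linear]): a disjoint edge turns 1 + Nt into 1 + (N + 1)t + Nt^2, and N
    vertices with b = 1, each contributing t - t^2, turn this into 1 + (2N + 1)t without
    changing the regularity. Then add d - 1 disjoint edges.

    Both constructions replace an ideal I by I + f L, where I is contained in L and f is
    a monomial that is a nonzerodivisor modulo I: for the edge, f is the quadric and L
    is R; for the new vertex, f is x_z and L is generated by variables. The exact
    sequence 0 -> I -> I + L -> I + f L -> 0 (direct sum in the middle, with shifts)
    controls everything. A mapping cone gives a resolution ([cone_exact]), which is
    minimal since the generators of the resolution of I have larger degrees than those
    of the resolution of L ([resolves_add_multiple]); so the graded Betti numbers are
    known. The numerator K of the Hilbert series over (1 - t)^n becomes
    (1 - t^e) K_I + t^e K_L, where e is the degree of f ([is_kpoly_add_multiple]).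
    The same cone, applied to one variable after the other, yields the Koszul complex
    and the numerator 1 of the polynomial ring itself.

    The Krull dimension is the number of vertices outside a minimum cover. Chains of
    ideals generated by variables give one inequality ([var_chain]). For the other,
    elements witnessing the inclusions in a chain of primes have independent monomials
    modulo the smallest prime ([chain_independent]), and there are too many of them if
    the chain is longer than the number of variables that are not in that prime
    ([prime_chain_le]). *)

Set Implicit Arguments.
Unset Strict Implicit.
Unset Printing Implicit Defensive.

Import GRing.Theory Num.Theory.
Local Open Scope ring_scope.

(** * Graded complexes and mapping cones *)

Section Resolutions.

Variables (k : fieldType) (n : nat).
Local Notation R := {mpoly k[n]}.
Implicit Types I J L : R -> Prop.

(** Degree 0 for the map of graded free modules given by M, when s and t are the
    degrees of the two bases. *)
Definition homog_mx p q (s : 'rV[nat]_p) (t : 'rV[nat]_q) (M : 'M[R]_(p, q)) :=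
  forall a b, M a b = 0 \/
    (t ord0 b <= s ord0 a)%N /\ M a b \is (s ord0 a - t ord0 b).-homog.

Definition nonunit_mx p q (M : 'M[R]_(p, q)) := forall a b, (M a b)@_0%MM = 0.

Definition rk (r : nat -> nat) i := if i is j.+1 then r j else 1%N.

(** F_0 = R is implicit: index i refers to F_(i+1), so that the complex from index 0
    on resolves the ideal itself, which is how mapping cones are taken below. *)
Record cplx := Cplx {
  crk : nat -> nat;
  cdg : forall i, 'rV[nat]_(crk i);
  cdif : forall i, 'M[R]_(crk i, rk crk i) }.

Definition fdg (C : cplx) i : 'rV[nat]_(rk (crk C) i) :=
  if i is j.+1 then cdg C j else 0.

Definition resolves I (C : cplx) : Prop :=
  [/\ forall i, homog_mx (cdg C i) (fdg C i) (cdif C i),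
      forall p, I p <-> exists w : 'rV_(crk C 0), w *m cdif C 0 = const_mx p
    & forall i (v : 'rV_(crk C i)), v *m cdif C i = 0 <->
        exists w : 'rV_(crk C i.+1), v = w *m cdif C i.+1].

Lemma homog_mx0 p q s t : homog_mx s t (0 : 'M[R]_(p, q)).
Proof. by move=> a b; left; rewrite mxE. Qed.

Lemma homog_mxN p q s t (M : 'M[R]_(p, q)) : homog_mx s t M -> homog_mx s t (- M).
Proof.
move=> h a b; rewrite mxE; case: (h a b) => [->|[le hM]].
  by left; rewrite oppr0.
by right; split=> //; rewrite rpredN.
Qed.

Lemma homog_col_mx p1 p2 q s1 s2 t (M1 : 'M[R]_(p1, q)) (M2 : 'M_(p2, q)) :
  homog_mx s1 t M1 -> homog_mx s2 t M2 ->
  homog_mx (row_mx s1 s2) t (col_mx M1 M2).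
Proof.
move=> h1 h2 a b; case: (split_ordP a) => j ->.
  by rewrite col_mxEu row_mxEl.
by rewrite col_mxEd row_mxEr.
Qed.

Lemma homog_row_mx p q1 q2 s t1 t2 (M1 : 'M[R]_(p, q1)) (M2 : 'M_(p, q2)) :
  homog_mx s t1 M1 -> homog_mx s t2 M2 ->
  homog_mx s (row_mx t1 t2) (row_mx M1 M2).
Proof.
move=> h1 h2 a b; case: (split_ordP b) => j ->; by rewrite !(row_mxEl, row_mxEr).
Qed.

Lemma homog_mx_shift p q e s t (M : 'M[R]_(p, q)) :
  homog_mx s t M -> homog_mx (map_mx (addn e) s) (map_mx (addn e) t) M.
Proof. by move=> h a b; rewrite !mxE leq_add2l subnDl. Qed.

Lemma nonunit_col_mx p1 p2 q (M1 : 'M[R]_(p1, q)) (M2 : 'M_(p2, q)) :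
  nonunit_mx M1 -> nonunit_mx M2 -> nonunit_mx (col_mx M1 M2).
Proof.
move=> h1 h2 a b; case: (split_ordP a) => j ->; by rewrite !(col_mxEu, col_mxEd).
Qed.

Lemma nonunit_row_mx p q1 q2 (M1 : 'M[R]_(p, q1)) (M2 : 'M_(p, q2)) :
  nonunit_mx M1 -> nonunit_mx M2 -> nonunit_mx (row_mx M1 M2).
Proof.
move=> h1 h2 a b; case: (split_ordP b) => j ->; by rewrite !(row_mxEl, row_mxEr).
Qed.

Lemma nonunit_mx0 p q : nonunit_mx (0 : 'M[R]_(p, q)).
Proof. by move=> a b; rewrite mxE mcoeff0. Qed.

Lemma nonunit_homog_mx p q s t (M : 'M[R]_(p, q)) :
  homog_mx s t M -> (forall a b, (t ord0 b < s ord0 a)%N) -> nonunit_mx M.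
Proof.
move=> hM lt a b; case: (hM a b) => [->|[_ h]]; first by rewrite mcoeff0.
apply: (dhomog_nemf_coeff h); rewrite /= mdeg0 eq_sym subn_eq0 -ltnNge.
exact: lt.
Qed.

Lemma pihomogMr d e (p q : R) : q \is e.-homog ->
  pihomog mdeg d (p * q) = if (e <= d)%N then pihomog mdeg (d - e) p * q else 0.
Proof.
move=> hq; set K := maxn (msize p) d.+1.
rewrite {1}(@pihomog_partitionE _ _ mdeg K p) ?leq_maxl //.
rewrite mulr_suml raddf_sum /=.
case: ifP => [le|/negbT]; last first.
  rewrite -ltnNge => lt; rewrite big1 // => i _.
  apply: (pihomog_ne0 (d := (i + e)%N)); last by rewrite dhomogM ?pihomogP.
  by rewrite gtn_eqF // ltn_addl.
have lt : (d - e < K)%N by rewrite /K leq_max ltnS leq_subr orbT.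
rewrite (bigD1 (Ordinal lt)) //= [X in X + _]pihomog_dE; last first.
  by rewrite -[X in X.-homog](subnK le) dhomogM ?pihomogP.
rewrite big1 ?addr0 // => i ne.
apply: (pihomog_ne0 (d := (i + e)%N)); last by rewrite dhomogM ?pihomogP.
by rewrite -[X in _ != X](subnK le) eqn_add2r.
Qed.

(** Projecting an arbitrary solution onto the degrees that the gradings prescribe
    gives a homogeneous one. *)
Lemma homog_mx_lift p q m s t u (M : 'M[R]_(p, q)) (D : 'M[R]_(m, q)) :
  homog_mx s t M -> homog_mx u t D ->
  (forall a, exists w, row a M = w *m D) ->
  exists2 X, homog_mx s u X & M = X *m D.
Proof.
move=> hM hD hl.
have [w hw] : exists w : 'I_p -> 'rV_m, forall a, row a M = w a *m D.
  exists (fun a => proj1_sig (constructive_indefinite_description _ (hl a))) => a.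
  by case: constructive_indefinite_description.
exists (\matrix_(a, c) if (u ord0 c <= s ord0 a)%N
          then pihomog mdeg (s ord0 a - u ord0 c) (w a ord0 c) else 0).
  move=> a c; rewrite mxE; case: ifP => le; last by left.
  by right; split=> //; apply: pihomogP.
apply/matrixP=> a b.
have eM : M a b = \sum_c w a ord0 c * D c b.
  by have /matrixP/(_ ord0 b) := hw a; rewrite !mxE.
rewrite mxE; have [le|lt] := leqP (t ord0 b) (s ord0 a); last first.
  have ->: M a b = 0 by case: (hM a b) => // -[]; rewrite leqNgt lt.
  rewrite big1 // => c _; rewrite mxE.
  case: (hD c b) => [->|[le' _]]; first by rewrite mulr0.
  by rewrite leqNgt (leq_trans lt le') mul0r.
have hMab : M a b \is (s ord0 a - t ord0 b).-homog.
  by case: (hM a b) => [->|[]//]; apply: rpred0.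
rewrite -(pihomog_dE hMab) eM raddf_sum /=.
apply: eq_bigr => c _; rewrite mxE.
case: (hD c b) => [->|[le' hDcb]]; first by rewrite !mulr0 pihomog0.
rewrite (pihomogMr _ _ hDcb) leq_sub2rE // subnBA // subnK //.
by case: ifP => // _; rewrite mul0r.
Qed.

Lemma homog_mxM p q m s t u (M : 'M[R]_(p, q)) (D : 'M[R]_(q, m)) :
  homog_mx s t M -> homog_mx t u D -> homog_mx s u (M *m D).
Proof.
move=> hM hD a b; rewrite mxE.
have [le|lt] := leqP (u ord0 b) (s ord0 a); last first.
  left; rewrite big1 // => c _.
  case: (hM a c) => [->|[le1 _]]; first by rewrite mul0r.
  case: (hD c b) => [->|[le2 _]]; first by rewrite mulr0.
  by move: (leq_trans le2 le1); rewrite leqNgt lt.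
right; split=> //; apply: rpred_sum => c _.
case: (hM a c) => [->|[le1 h1]]; first by rewrite mul0r rpred0.
case: (hD c b) => [->|[le2 h2]]; first by rewrite mulr0 rpred0.
have -> : (s ord0 a - u ord0 b = (s ord0 a - t ord0 c) + (t ord0 c - u ord0 b))%N.
  by rewrite addnBA // subnK.
exact: dhomogM.
Qed.

Lemma homog_scalar_mx p e s (f : R) : f \is e.-homog ->
  homog_mx (map_mx (addn e) s) s (f%:M : 'M[R]_p).
Proof.
move=> hf a b; rewrite !mxE.
case: eqVneq => [->|_]; last by left.
by right; rewrite leq_addl addnK.
Qed.

Lemma dependent_choice (T : nat -> Type) (P : forall i, T i -> Prop)
    (Q : forall i, T i -> T i.+1 -> Prop) (x0 : T 0%N) :
  P 0%N x0 -> (forall i x, P i x -> exists2 y, P i.+1 y & Q i x y) ->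
  exists2 f : forall i, T i, f 0%N = x0 & forall i, P i (f i) /\ Q i (f i) (f i.+1).
Proof.
move=> P0 PS.
have step i (x : {x | P i x}) : {y : {y | P i.+1 y} | Q i (sval x) (sval y)}.
  apply: constructive_indefinite_description.
  by case: x => x Px; have [y Py Qxy] := PS i x Px; exists (exist _ y Py).
pose g := nat_rect (fun i => {x | P i x}) (exist _ x0 P0) (fun i x => sval (step i x)).
exists (fun i => sval (g i)) => // i; split; first exact: (svalP (g i)).
exact: (svalP (step i (g i))).
Qed.

Lemma resolves_comp0 I C i : resolves I C -> cdif C i.+1 *m cdif C i = 0.
Proof.
case=> _ _ ex; apply/row_matrixP=> a; rewrite row_mul row0.
by apply/(ex i); exists (delta_mx 0 a); rewrite -rowE.
Qed.

(** Free modules are projective, so the inclusion of I in L lifts step by step to a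
    homogeneous map of resolutions. *)
Lemma comparison I L A K : resolves I A -> resolves L K ->
  (forall p, I p -> L p) ->
  exists phi : forall i, 'M[R]_(rk (crk A) i, rk (crk K) i),
    [/\ phi 0%N = 1%:M,
        forall i, homog_mx (fdg A i) (fdg K i) (phi i)
      & forall i, phi i.+1 *m cdif K i = cdif A i *m phi i].
Proof.
move=> rA rK IL.
have [hA eA _] := rA; have [hK eK xK] := rK.
pose P i (X : 'M[R]_(rk (crk A) i, rk (crk K) i)) :=
  homog_mx (fdg A i) (fdg K i) X /\
  forall a, exists w, row a (cdif A i *m X) = w *m cdif K i.
pose Q i (X : 'M[R]_(rk (crk A) i, rk (crk K) i))
  (Y : 'M[R]_(rk (crk A) i.+1, rk (crk K) i.+1)) := Y *m cdif K i = cdif A i *m X.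
have P0 : P 0%N 1%:M.
  split=> [a b|a].
    by right; rewrite !mxE !ord1; split=> //; apply: dhomog1.
  have Ia : I (row a (cdif A 0) ord0 ord0).
    apply/eA; exists (delta_mx 0 a); rewrite -rowE.
    by apply/rowP=> j; rewrite !ord1 [RHS]mxE.
  have [w hw] := (eK _).1 (IL _ Ia).
  by exists w; rewrite hw mulmx1; apply/rowP=> j; rewrite !mxE !ord1.
have PS i X : P i X -> exists2 Y, P i.+1 Y & Q i X Y.
  case=> hX lX; have [Y hY eY] := homog_mx_lift (homog_mxM (hA i) hX) (hK i) lX.
  exists Y => //; split=> // a; apply/(xK i).
  by rewrite -row_mul -mulmxA -eY mulmxA (resolves_comp0 _ rA) mul0mx row0.
have [phi phi0 hphi] := dependent_choice P0 PS.
by exists phi; split=> // i; have [[]] := hphi i.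
Qed.

(** Resolution of J = I + f L, where I is contained in L and f, of degree e, is a
    nonzerodivisor modulo I. Then I and f L meet in f I, so that
      0 -> I(-e) -> I + L(-e) -> J -> 0,   u |-> (f u, - u),
    with a direct sum in the middle, is exact. The cone of the lift of the first
    map, whose second component is the comparison map phi, resolves J: its modules
    are the sums of A_i, K_i(-e) and A_(i-1)(-e). *)
Section Cone.

Variables (e : nat) (f : R) (A K : cplx).
Variable phi : forall i, 'M[R]_(rk (crk A) i, rk (crk K) i).

(** The shifted copy of A has nothing to contribute at index 0; prk, pdg and pdif
    describe A one index lower, with a zero module there. *)
Definition prk i := if i is j.+1 then crk A j else 0%N.
Definition pdg i : 'rV[nat]_(prk i) := if i is j.+1 then cdg A j else 0.
Definition pdif i : 'M[R]_(crk A i, prk i) := if i is j.+1 then cdif A j.+1 else 0.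

Definition cone_rk i := (crk A i + (crk K i + prk i))%N.

Definition cone_dg i : 'rV[nat]_(cone_rk i) :=
  row_mx (cdg A i) (row_mx (map_mx (addn e) (cdg K i)) (map_mx (addn e) (pdg i))).

Definition cone_dif i : 'M[R]_(cone_rk i, rk cone_rk i) :=
  if i is j.+1 then
    col_mx (row_mx (cdif A j.+1) 0)
   (col_mx (row_mx 0 (row_mx (cdif K j.+1) 0))
           (row_mx f%:M (row_mx (- phi j.+1) (- pdif j))))
  else col_mx (cdif A 0) (col_mx (f *: cdif K 0) 0).

Definition cone := Cplx cone_dg cone_dif.

Lemma cone_homog : f \is e.-homog ->
  (forall i, homog_mx (cdg A i) (fdg A i) (cdif A i)) ->
  (forall i, homog_mx (cdg K i) (fdg K i) (cdif K i)) ->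
  (forall i, homog_mx (fdg A i) (fdg K i) (phi i)) ->
  forall i, homog_mx (cdg cone i) (fdg cone i) (cdif cone i).
Proof.
move=> hf hA hK hphi [|i] /=; rewrite /cone_dg.
  apply: homog_col_mx; first exact: hA.
  apply: homog_col_mx; last exact: homog_mx0.
  move=> a b; rewrite !mxE; case: (hK 0%N a b) => [->|[_]].
    by rewrite mulr0; left.
  by rewrite /= mxE subn0 => h; right; rewrite subn0; split=> //; apply: dhomogM.
apply: homog_col_mx; last apply: homog_col_mx.
- by apply: homog_row_mx; [apply: hA | apply: homog_mx0].
- apply: homog_row_mx; first exact: homog_mx0.
  apply: homog_row_mx; last exact: homog_mx0.
  exact: (homog_mx_shift e (hK i.+1)).
apply: homog_row_mx; first exact: homog_scalar_mx.
apply: homog_row_mx; apply/homog_mxN/homog_mx_shift; first exact: (hphi i.+1).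
by case: i => [|i]; [apply: homog_mx0 | apply: hA].
Qed.

(** The only blocks of the cone that are not blocks of A or K are f and phi; the map
    K_0 -> R of the complex K occurs multiplied by f, so it may contain units. *)
Lemma cone_nonunit : f@_0%MM = 0 ->
  (forall i, nonunit_mx (cdif A i)) -> (forall i, nonunit_mx (cdif K i.+1)) ->
  (forall i, nonunit_mx (phi i.+1)) -> forall i, nonunit_mx (cdif cone i).
Proof.
move=> f0 hA hK hphi.
have nonunitN p q (M : 'M[R]_(p, q)) : nonunit_mx M -> nonunit_mx (- M).
  by move=> h a b; rewrite mxE mcoeffN h oppr0.
case=> [|i] /=.
  apply: nonunit_col_mx; first exact: hA.
  apply: nonunit_col_mx; last exact: nonunit_mx0.
  move=> a b; rewrite mxE.
  by have := rmorphM (mcoeff 0%MM) f (cdif K 0 a b); rewrite /= f0 mul0r.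
apply: nonunit_col_mx; last apply: nonunit_col_mx.
- by apply: nonunit_row_mx; [apply: hA | apply: nonunit_mx0].
- apply: nonunit_row_mx; first exact: nonunit_mx0.
  by apply: nonunit_row_mx; [apply: hK | apply: nonunit_mx0].
apply: nonunit_row_mx; last apply: nonunit_row_mx.
- by move=> a b; rewrite mxE; case: eqP => _; rewrite ?mulr1n ?mulr0n ?mcoeff0.
- exact: nonunitN (hphi i).
by apply: nonunitN; case: i => [|i]; [apply: nonunit_mx0 | apply: hA].
Qed.

Lemma mul_cone_dif0 (u : 'rV_(crk A 0)) (v : 'rV_(crk K 0)) (w : 'rV_0) :
  row_mx u (row_mx v w) *m cone_dif 0 = u *m cdif A 0 + f *: (v *m cdif K 0).
Proof. by rewrite /cone_dif !mul_row_col mulmx0 addr0 scalemxAr. Qed.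

Lemma mul_cone_difS i (u : 'rV_(crk A i.+1)) (v : 'rV_(crk K i.+1))
    (w : 'rV_(crk A i)) :
  row_mx u (row_mx v w) *m cone_dif i.+1 =
  row_mx (u *m cdif A i.+1 + f *: w)
    (row_mx (v *m cdif K i.+1 - w *m phi i.+1) (- (w *m pdif i))).
Proof.
rewrite /cone_dif !mul_row_col !mul_mx_row !mulmx0 !add_row_mx mul_mx_scalar.
by rewrite !add0r !mulmxN.
Qed.

Lemma cone_exact I L J : f != 0 -> resolves I A -> resolves L K ->
  phi 0%N = 1%:M -> (forall i, phi i.+1 *m cdif K i = cdif A i *m phi i) ->
  (forall p, I p -> L p) -> (forall p, I (f * p) -> I p) -> is_ideal I ->
  (forall p, J p <-> exists a b, [/\ I a, L b & p = a + f * b]) ->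
  (forall p, J p <->
     exists w : 'rV_(crk cone 0), w *m cdif cone 0 = const_mx p) /\
  (forall i (v : 'rV_(crk cone i)), v *m cdif cone i = 0 <->
     exists w : 'rV_(crk cone i.+1), v = w *m cdif cone i.+1).
Proof.
move=> f0 rA rK phi0 hphi IL regf idI eJ.
have [_ eA xA] := rA; have [_ eK xK] := rK.
split=> [p|].
  rewrite eJ; split=> [[a [b [/eA[u hu] /eK[v hv] ->]]]|[w]].
    exists (row_mx u (row_mx v 0)); rewrite mul_cone_dif0 hu hv.
    by apply/rowP=> j; rewrite !mxE.
  rewrite -[w]hsubmxK -[rsubmx w]hsubmxK mul_cone_dif0 => /rowP/(_ 0).
  rewrite [RHS]mxE [LHS]mxE [X in _ + X]mxE => <-.
  do 2!eexists; split; last reflexivity; [apply/eA | apply/eK].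
    by exists (lsubmx w); apply/rowP=> j; rewrite ord1 [RHS]mxE.
  by exists (lsubmx (rsubmx w)); apply/rowP=> j; rewrite ord1 [RHS]mxE.
have fI p q (M : 'M[R]_(p, q)) : f *: M = 0 -> M = 0.
  move=> /matrixP h; apply/matrixP=> a b; have := h a b; rewrite !mxE => /eqP.
  by rewrite mulf_eq0 (negbTE f0) => /eqP.
(* If the third component of a cycle is the boundary of w', adding the boundary of
   w' to the cycle leaves a pair of cycles of A and K. *)
have bound i (u : 'rV_(crk A i)) v w' : (u + f *: w') *m cdif A i = 0 ->
    (v - w' *m phi i.+1) *m cdif K i = 0 ->
    exists y, row_mx u (row_mx v (w' *m pdif i)) = y *m cone_dif i.+1.
  move=> /xA[u' hu] /xK[v' hv]; exists (row_mx u' (row_mx v' (- w'))).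
  by rewrite mul_cone_difS -hu -hv !mulNmx opprK scalerN addrK opprK subrK.
have dA := resolves_comp0 _ rA; have dK := resolves_comp0 _ rK.
have comp0 i (y : 'rV_(crk cone i.+1)) : y *m cone_dif i.+1 *m cone_dif i = 0.
  rewrite -[y]hsubmxK -[rsubmx y]hsubmxK mul_cone_difS.
  move: (lsubmx y) (lsubmx (rsubmx y)) (rsubmx (rsubmx y)) => {y} u v w.
  case: i u v w => [|i] u v w /=.
    rewrite mul_cone_dif0 mulmxDl mulmxBl -!mulmxA dA dK !mulmx0.
    by rewrite hphi phi0 mulmx1 add0r sub0r -scalemxAl scalerN subrr.
  rewrite mul_cone_difS !mulmxDl !mulNmx -!mulmxA dA dK !mulmx0.
  rewrite -scalemxAl scalerN add0r subrr hphi sub0r mulmxA opprK addNr.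
  by case: i u v w => [|i] u v w; rewrite /= ?mulmx0 ?dA ?mulmx0 !oppr0 !row_mx0.
case=> [|i] z; split=> [|[y ->]]; try exact: comp0.
  rewrite -[z]hsubmxK -[rsubmx z]hsubmxK mul_cone_dif0.
  set u := lsubmx z; set v := lsubmx _; move: (rsubmx _) => w /= uv0.
  (* f q lies in I, hence so does q, since f is a nonzerodivisor modulo I. *)
  have [w' hw'] : exists w', v *m cdif K 0 = w' *m cdif A 0.
    pose q := (v *m cdif K 0) ord0 ord0.
    have /eA[w' hw'] : I q.
      apply: regf; have [_ _ mI] := idI.
      have -> : f * q = - 1 * (u *m cdif A 0) ord0 ord0.
        move/rowP/(_ ord0): uv0.
        rewrite [RHS]mxE [LHS]mxE [X in _ + X]mxE => /eqP.
        by rewrite addrC addr_eq0 mulN1r => /eqP.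
      apply: mI; apply/eA; exists u.
      by apply/rowP=> j; rewrite ord1 [RHS]mxE.
    by exists w'; rewrite hw'; apply/rowP=> j; rewrite ord1 [RHS]mxE.
  have -> : w = w' *m pdif 0 by apply/matrixP=> a [].
  apply: bound; first by rewrite mulmxDl -scalemxAl -hw'.
  by rewrite mulmxBl -mulmxA hphi phi0 mulmx1 hw' subrr.
rewrite -[z]hsubmxK -[rsubmx z]hsubmxK mul_cone_difS.
set u := lsubmx z; set v := lsubmx _; move: (rsubmx _) => w /= h.
have [/eq_row_mx[hu /eq_row_mx[hv _]]] : row_mx (u *m cdif A i.+1 + f *: w)
   (row_mx (v *m cdif K i.+1 - w *m phi i.+1) (- (w *m pdif i))) =
   row_mx 0 (row_mx 0 0) by rewrite !row_mx0.
(* Applying the differential of A to the first component gives f (w d) = 0. *)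
have /xA[w' hw'] : w *m cdif A i = 0.
  apply: fI; move/(congr1 (mulmx^~ (cdif A i))): hu.
  by rewrite mulmxDl -mulmxA dA mulmx0 add0r mul0mx -scalemxAl.
have -> : w = w' *m pdif i.+1 by [].
apply: bound; first by rewrite mulmxDl -scalemxAl -hw'.
by rewrite mulmxBl -mulmxA hphi mulmxA -hw'.
Qed.

End Cone.

End Resolutions.

(** * Betti numbers and regularity from a minimal complex *)

Section FreeComplex.

Variables (k : fieldType) (n : nat).
Local Notation R := {mpoly k[n]}.

Section Conversion.

Variable C : cplx k n.

Definition sh i : seq nat := [seq fdg C i ord0 a | a <- enum 'I_(rk (crk C) i)].

Lemma size_sh i : size (sh i) = rk (crk C) i.
Proof. by rewrite size_map size_enum_ord. Qed.

Lemma nth_sh i (a : 'I_(size (sh i))) :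
  nth 0%N (sh i) a = fdg C i ord0 (cast_ord (size_sh i) a).
Proof.
have lt : (a < size (enum 'I_(rk (crk C) i)))%N.
  by rewrite size_enum_ord -size_sh.
rewrite (nth_map (cast_ord (size_sh i) a)) //; congr (fdg C i _ _).
by apply: val_inj; rewrite /= nth_enum_ord // -size_sh.
Qed.

Definition to_free_cplx : free_cplx k n := FreeCplx (shift := sh)
  (fun i => castmx (esym (size_sh i.+1), esym (size_sh i)) (cdif C i)).

Lemma mul_castmx m m' p p' (em : m = m') (ep : p = p') (M : 'M[R]_(m, p)) v :
  v *m castmx (em, ep) M =
  castmx (erefl 1%N, ep) (castmx (erefl 1%N, esym em) v *m M).
Proof. by case: _ / em v; case: _ / ep => v; rewrite !castmx_id. Qed.

Lemma castmx_eq0 m m' (e : m = m') (v : 'rV[R]_m) :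
  castmx (erefl 1%N, e) v = 0 <-> v = 0.
Proof. by case: _ / e; rewrite castmx_id. Qed.

Lemma to_free_cplx_res I : resolves I C -> (forall i, nonunit_mx (cdif C i)) ->
  is_min_graded_free_res I to_free_cplx.
Proof.
case=> hC eC xC minC; split.
- move=> i a b s t; rewrite {}/s {}/t !nth_sh castmxE !esymK.
  exact: (hC i (cast_ord (size_sh i.+1) a) (cast_ord (size_sh i) b)).
- by move=> i a b; rewrite castmxE; apply: minC.
split.
- by rewrite /= /sh /= enum_ordSl enum_ord0 /= mxE.
- move=> p; rewrite eC; split=> [[w hw]|[w]].
    exists (castmx (erefl 1%N, esym (size_sh 1)) w).
    rewrite mul_castmx castmx_comp castmx_id hw.
    by apply/rowP=> j; rewrite castmxE !mxE.
  rewrite mul_castmx => /(congr1 (castmx (erefl 1%N, size_sh 0))).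
  rewrite castmx_comp castmx_id => hw.
  exists (castmx (erefl 1%N, esym (esym (size_sh 1))) w); rewrite [LHS]hw.
  by apply/rowP=> j; rewrite castmxE !mxE.
move=> i v; rewrite mul_castmx castmx_eq0.
rewrite (xC i); split=> [[w hw]|[w ->]].
  exists (castmx (erefl 1%N, esym (size_sh i.+2)) w).
  rewrite mul_castmx castmx_comp castmx_id -hw castmx_comp.
  by rewrite castmx_id.
eexists; rewrite mul_castmx castmx_comp castmx_id; reflexivity.
Qed.

Lemma mem_sh i j : reflect (exists a, fdg C i ord0 a = j) (j \in sh i).
Proof.
apply: (iffP mapP) => [[a _ ->]|[a <-]]; first by exists a.
by exists a => //; rewrite mem_enum.
Qed.

(** The degrees of a minimal resolution are the ones where a Betti number is
    nonzero, and F_0 = R contributes the value 0 of j - i. *)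
Lemma resolves_reg I rho : resolves I C -> (forall i, nonunit_mx (cdif C i)) ->
  (forall i a, (cdg C i ord0 a <= i.+1 + rho)%N) ->
  rho = 0%N \/ (exists i a, cdg C i ord0 a = (i.+1 + rho)%N) ->
  is_reg_quot I rho%:Z.
Proof.
move=> rC minC ub att.
exists (fun i j => count_mem j (sh i)).
  by exists to_free_cplx => //; apply: to_free_cplx_res.
have bettiP i j : count_mem j (sh i) <> 0%N <-> exists a, fdg C i ord0 a = j.
  have -> : (count_mem j (sh i) <> 0%N) <-> (j \in sh i).
    by rewrite -has_pred1 has_count lt0n; split=> /eqP.
  by split=> /mem_sh.
split; last first.
  move=> [|i] j /bettiP[a <-] /=; first by rewrite mxE; lia.
  by have := ub i a; lia.
case: att => [->|[i [a h]]].
  by exists 0%N, 0%N; split=> //; apply/bettiP; exists ord0; rewrite /= mxE.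
exists i.+1, (i.+1 + rho)%N; split; last by lia.
by apply/bettiP; exists a.
Qed.

End Conversion.

End FreeComplex.

(** * Monomial ideals and their resolutions *)

Section MonomialIdeals.

Variables (k : fieldType) (n : nat).
Local Notation R := {mpoly k[n]}.
Implicit Types (b : pred 'X_{1..n}) (m mu : 'X_{1..n}) (W : {set 'I_n}).

(** The monomials satisfying b span an ideal when b is closed under multiplication;
    ideals are handled through these predicates on monomials. *)
Definition mideal b (p : R) : Prop := {subset msupp p <= b}.

Definition upclosed b := forall m m', b m -> b (m' + m)%MM.

(** The monomials of I + x^mu L, for I and L spanned by b and b'. *)
Definition add_multiple mu b b' : pred 'X_{1..n} :=
  fun m => b m || (mu <= m)%MM && b' (m - mu)%MM.

Lemma mideal0 b : mideal b 0.
Proof. by move=> m; rewrite msupp0. Qed.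

Lemma midealD b p q : mideal b p -> mideal b q -> mideal b (p + q).
Proof.
move=> hp hq m /msuppD_le; rewrite mem_cat => /orP[]; [exact: hp | exact: hq].
Qed.

Lemma midealX b m (c : k) : b m -> mideal b (c *: 'X_[m]).
Proof. by move=> bm m' /msuppZ_le/mem_msuppXP <-. Qed.

Lemma mideal_ideal b : upclosed b -> is_ideal (mideal b).
Proof.
move=> up; split; [exact: mideal0 | exact: midealD |].
move=> a p hp m /msuppM_le/allpairsP[[m1 m2] /= [_ /hp h ->]]; exact: up.
Qed.

Lemma eq_mideal b b' : b =1 b' -> forall p, mideal b p <-> mideal b' p.
Proof. by move=> e p; split=> h m /h; rewrite !unfold_in e. Qed.

Lemma mideal_mulX b mu p :
  mideal b ('X_[mu] * p) <-> mideal (fun m => b (mu + m)%MM) p.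
Proof.
split=> h m; last first.
  rewrite mulrC (perm_mem (msuppMX _ _)) => /mapP[m' /h + ->].
  by rewrite !unfold_in.
move=> hm; rewrite unfold_in; apply: h.
by rewrite mulrC (perm_mem (msuppMX _ _)) map_f.
Qed.

Lemma mideal_add_multiple mu b b' p :
  mideal (add_multiple mu b b') p <->
  exists q r, [/\ mideal b q, mideal b' r & p = q + 'X_[mu] * r].
Proof.
split=> [hp|[q [r [hq hr ->]]]]; last first.
  apply: midealD; first by move=> m /hq; rewrite !unfold_in => ->.
  apply/mideal_mulX => m /hr; rewrite !unfold_in => h.
  by rewrite /add_multiple lem_addr addmC addmK [b' m]h orbT.
exists (\sum_(m <- msupp p | b m) p@_m *: 'X_[m]).
exists (\sum_(m <- msupp p | ~~ b m) p@_m *: 'X_[m - mu]); split.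
- apply: (big_ind (mideal b)); [exact: mideal0 | exact: midealD |].
  by move=> m bm; apply: midealX.
- rewrite big_seq_cond; apply: (big_ind (mideal b'));
    [exact: mideal0 | exact: midealD |].
  move=> m /andP[/hp]; rewrite unfold_in => /orP[->//|/andP[_ bm] _].
  exact: midealX.
rewrite {1}[p]mpolyE (bigID b) /=; congr (_ + _).
rewrite mulr_sumr big_seq_cond [RHS]big_seq_cond; apply: eq_bigr => m /andP[/hp].
rewrite unfold_in => /orP[->//|/andP[le _] _].
by rewrite -scalerAr -mpolyXD addmC submK.
Qed.

(** The comparison map goes from generators of larger degree to generators of smaller
    degree, so no unit can appear in it and the cone is minimal. *)
Lemma resolves_add_multiple mu b b' (A K : cplx k n) : mu != 0%MM ->
  upclosed b -> subpred b b' -> (forall m, b (mu + m)%MM -> b m) ->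
  resolves (mideal b) A -> resolves (mideal b') K ->
  (forall i, nonunit_mx (cdif A i)) -> (forall i, nonunit_mx (cdif K i.+1)) ->
  (forall i x y, cdg K i ord0 y < cdg A i ord0 x)%N ->
  exists phi, let C := cone (mdeg mu) 'X_[mu] (A := A) (K := K) phi in
    resolves (mideal (add_multiple mu b b')) C /\ forall i, nonunit_mx (cdif C i).
Proof.
move=> mu0 up bb' reg rA rK uA uK lt.
have sub p : mideal b p -> mideal b' p.
  by move=> h m /h; rewrite !unfold_in; apply: bb'.
have [phi [phi0 hphi ephi]] := comparison rA rK sub.
exists phi => C.
have hX : 'X_[k, mu] \is (mdeg mu).-homog by rewrite dhomogX.
have [ex1 ex2] : (forall p, mideal (add_multiple mu b b') p <->
     exists w : 'rV_(crk C 0), w *m cdif C 0 = const_mx p) /\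
  (forall i (v : 'rV_(crk C i)), v *m cdif C i = 0 <->
     exists w : 'rV_(crk C i.+1), v = w *m cdif C i.+1).
  apply: (cone_exact (mdeg mu) (I := mideal b) (L := mideal b')) => //.
  - by rewrite -msupp_eq0 msuppX.
  - by move=> p /mideal_mulX h m /h; rewrite !unfold_in; apply: reg.
  - exact: mideal_ideal.
  - exact: mideal_add_multiple.
split; last first.
  apply: cone_nonunit => // [|i].
    by rewrite mcoeffX (negbTE mu0).
  by apply: nonunit_homog_mx (hphi i.+1) _ => x y; apply: lt.
split=> // i; apply: cone_homog => //; by [case: rA | case: rK].
Qed.

Lemma eq_resolves I J (C : cplx k n) : (forall p, I p <-> J p) ->
  resolves I C -> resolves J C.
Proof. by move=> e [h1 h2 h3]; split=> // p; rewrite -e. Qed.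

Definition zero_cplx : cplx k n := Cplx (crk := fun=> 0%N) (fun=> 0) (fun=> 0).

Lemma resolves_zero : resolves (mideal pred0) zero_cplx.
Proof.
split=> [i [] //|p|i v].
  split=> [h|[w]]; last first.
    rewrite thinmx0 mul0mx => /rowP/(_ ord0); rewrite !mxE => <-; exact: mideal0.
  exists 0; rewrite mul0mx; suff -> : p = 0 by apply/rowP=> j; rewrite !mxE.
  apply/eqP; rewrite -msupp_eq0; apply/eqP.
  by case: (msupp p) (h : {subset msupp p <= pred0}) => // m s /(_ m (mem_head _ _)).
by split=> _; [exists 0; apply/rowP; case | rewrite mulmx0].
Qed.

Definition unit_rk i := if i is 0%N then 1%N else 0%N.

(** The nonminimal resolution 0 -> R -> R of R/R = 0. Taking L = R in the cone adjoins
    a regular element to I, and the unit entry disappears because it gets multiplied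
    by that element. *)
Definition unit_cplx : cplx k n := Cplx (crk := unit_rk) (fun=> 0)
  (fun i => if i is 0%N return 'M_(unit_rk i, rk unit_rk i) then 1%:M else 0).

Lemma resolves_unit : resolves (mideal predT) unit_cplx.
Proof.
split=> [[|i] //|p|[|i] v].
- by move=> a b; right; rewrite !mxE !ord1; split=> //; apply: dhomog1.
- by case.
- by split=> // _; exists (const_mx p); rewrite mulmx1.
- rewrite /= mulmx1; split=> [->|[w ->]]; last by rewrite thinmx0 mul0mx.
  by exists 0; rewrite mul0mx.
by split=> _; [exists 0; apply/rowP; case | rewrite mulmx0].
Qed.

Definition var_pred W : pred 'X_{1..n} := fun m => [exists i in W, m i != 0%N].

Lemma var_predP W m : reflect (exists2 i, i \in W & m i != 0%N) (var_pred W m).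
Proof. exact: exists_inP. Qed.

Lemma upclosed_var W : upclosed (var_pred W).
Proof.
move=> m m' /var_predP[i Wi mi]; apply/var_predP; exists i => //.
by rewrite mnmDE addn_eq0 negb_and mi orbT.
Qed.

Lemma var_predU1 w W :
  add_multiple U_(w)%MM (var_pred W) predT =1 var_pred (w |: W).
Proof.
move=> m; rewrite /add_multiple /= andbT lep1mP.
apply/orP/var_predP => [[/var_predP[i Wi mi]|mw]|[i]].
- by exists i => //; rewrite inE Wi orbT.
- by exists w; rewrite ?setU11.
rewrite !inE => /orP[/eqP->|Wi] mi; [by right | left].
by apply/var_predP; exists i.
Qed.

Lemma var_pred_mul w W m : w \notin W -> var_pred W (U_(w) + m)%MM -> var_pred W m.
Proof.
move=> nWw /var_predP[i Wi]; rewrite mnmDE mnm1E.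
case: (eqVneq w i) => [e|_ mi]; first by rewrite e Wi in nWw.
by apply/var_predP; exists i.
Qed.


Lemma var_pred0 : var_pred set0 =1 pred0.
Proof. by move=> m; apply/var_predP => -[i]; rewrite inE. Qed.

(** The Koszul complex, built by adjoining one variable at a time. *)
Lemma resolves_var W : exists C : cplx k n,
  [/\ resolves (mideal (var_pred W)) C, forall i, nonunit_mx (cdif C i),
      forall i a, cdg C i ord0 a = i.+1 & W != set0 -> (0 < crk C 0)%N].
Proof.
rewrite -[W]set_enum; elim: (enum W) (enum_uniq W) => {W} [_|w s IH].
  have -> : [set x in [::]] = set0 :> {set 'I_n} by apply/setP=> x; rewrite !inE.
  exists zero_cplx; split=> // [|i [] //|i [] //|]; last by rewrite eqxx.
  by apply: eq_resolves resolves_zero => p; apply: eq_mideal => m; rewrite var_pred0.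
rewrite cons_uniq set_cons; set W := [set x in s] => /andP[ws /IH[A [rA uA dA _]]].
have nWw : w \notin W by rewrite inE.
have w0 : U_(w)%MM != 0%MM :> 'X_{1..n} by rewrite mnm1_eq0.
have uK i : nonunit_mx (cdif unit_cplx i.+1) by move=> a b; rewrite mxE mcoeff0.
have lt i x y : (cdg unit_cplx i ord0 y < cdg A i ord0 x)%N by rewrite mxE dA.
have [phi [rC uC]] := resolves_add_multiple w0 (@upclosed_var W) (fun _ _ => isT)
  (fun m => @var_pred_mul w W m nWw) rA resolves_unit uA uK lt.
rewrite mdeg1 in rC uC.
exists (cone 1 'X_w phi); split=> //.
- by apply: eq_resolves rC => p; apply: eq_mideal; apply: var_predU1.
- move=> i a; rewrite /= /cone_dg.
  case: (split_ordP a) => x ->; first by rewrite row_mxEl dA.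
  rewrite row_mxEr; case: (split_ordP x) => y ->.
    by rewrite row_mxEl !mxE addn0; case: (i) y => [|j] [].
  rewrite row_mxEr mxE; move: y {a x}; case: i => [|i] y; first by case: y.
  by rewrite /pdg dA.
by move=> _; rewrite /= /cone_rk addn_gt0 orbT.
Qed.

End MonomialIdeals.

(** * Regularity and Hilbert series under the two constructions *)

Section Regularity.

Variables (k : fieldType) (n : nat).
Implicit Types (b : pred 'X_{1..n}) (m mu : 'X_{1..n}) (W : {set 'I_n}).

(** The lower bound on the degrees expresses that the ideal is generated in degrees at
    least 2, and rho = 0 is attained by F_0 = R. *)
Definition min_res_reg b rho := exists C : cplx k n,
  [/\ resolves (mideal b) C, forall i, nonunit_mx (cdif C i),
      forall i a, (i.+1 < cdg C i ord0 a <= i.+1 + rho)%N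
    & rho = 0%N \/ exists i a, cdg C i ord0 a = (i.+1 + rho)%N].

Lemma min_res_reg0 : min_res_reg pred0 0.
Proof.
exists (zero_cplx k n); split; [exact: resolves_zero | by move=> i [] | by move=> i [] |].
by left.
Qed.

Lemma min_res_reg_ext b b' rho : b =1 b' -> min_res_reg b rho -> min_res_reg b' rho.
Proof.
move=> e [C [rC uC dC aC]]; exists C; split=> //.
by apply: eq_resolves rC => p; apply: eq_mideal.
Qed.

(** Adjoining a regular quadric tensors the resolution with 0 -> R(-2) -> R, which
    raises the regularity by 1. *)
Lemma min_res_reg_quadric mu b rho : mdeg mu = 2%N -> upclosed b ->
  (forall m, b (mu + m)%MM -> b m) -> min_res_reg b rho ->
  min_res_reg (add_multiple mu b predT) rho.+1.
Proof.
move=> mu2 up reg [A [rA uA dA aA]].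
have mu0 : mu != 0%MM by rewrite -mdeg_eq0 mu2.
have uK i : nonunit_mx (cdif (unit_cplx k n) i.+1).
  by move=> a c; rewrite mxE mcoeff0.
have lt i x y : (cdg (unit_cplx k n) i ord0 y < cdg A i ord0 x)%N.
  by rewrite mxE; have := dA i x; lia.
have [phi [rC uC]] := resolves_add_multiple mu0 up (fun _ _ => isT)
  reg rA (resolves_unit k n) uA uK lt.
rewrite mu2 in rC uC; exists (cone 2 'X_[mu] phi); split=> //.
  move=> i a; rewrite /= /cone_dg.
  case: (split_ordP a) => x ->; first by rewrite row_mxEl; have := dA i x; lia.
  rewrite row_mxEr; case: (split_ordP x) => y ->.
    by rewrite row_mxEl !mxE addn0; case: (i) y => [|j] [] //=; lia.
  rewrite row_mxEr mxE; move: y {a x}; case: i => [|i] y; first by case: y.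
  by rewrite /pdg; move: (dA i y); set t := cdg A i ord0 y; lia.
right; case: aA => [->|[i [a ha]]].
  exists 0%N, (rshift (crk A 0) (lshift 0 ord0)).
  by rewrite /= /cone_dg row_mxEr (row_mxEl (map_mx _ _)) !mxE.
exists i.+1, (rshift (crk A i.+1) (rshift 0 a)).
by rewrite /= /cone_dg row_mxEr (row_mxEr (map_mx _ _)) !mxE /= ha; lia.
Qed.

(** The new blocks are a Koszul complex shifted by 1, which is linear of regularity 1,
    and a copy of the old resolution moved by 1 in both degrees, which has the old
    regularity. *)
Lemma min_res_reg_suspension z W b rho : W != set0 -> upclosed b ->
  subpred b (var_pred W) -> (forall m, b (U_(z) + m)%MM -> b m) ->
  min_res_reg b rho ->
  min_res_reg (add_multiple U_(z)%MM b (var_pred W)) (maxn rho 1).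
Proof.
move=> W0 up sub reg [A [rA uA dA aA]].
have z0 : U_(z)%MM != 0%MM :> 'X_{1..n} by rewrite mnm1_eq0.
have [K [rK uK dK /(_ W0) K0]] := resolves_var k W.
have lt i x y : (cdg K i ord0 y < cdg A i ord0 x)%N.
  by rewrite dK; have := dA i x; lia.
have [phi [rC uC]] :=
  resolves_add_multiple z0 up sub reg rA rK uA (fun i => uK i.+1) lt.
rewrite mdeg1 in rC uC; exists (cone 1 'X_z phi); split=> //.
  move=> i a; rewrite /= /cone_dg.
  case: (split_ordP a) => x ->; first by rewrite row_mxEl; have := dA i x; lia.
  rewrite row_mxEr; case: (split_ordP x) => y ->.
    by rewrite row_mxEl !mxE dK; lia.
  rewrite row_mxEr mxE; move: y {a x}; case: i => [|i] y; first by case: y.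
  by rewrite /pdg; move: (dA i y); set t := cdg A i ord0 y; lia.
right; case: aA => [->|[i [a ha]]].
  exists 0%N, (rshift (crk A 0) (lshift 0 (Ordinal K0))).
  by rewrite /= /cone_dg row_mxEr (row_mxEl (map_mx _ _)) !mxE dK.
have [->|r0] := posnP rho.
  exists 0%N, (rshift (crk A 0) (lshift 0 (Ordinal K0))).
  by rewrite /= /cone_dg row_mxEr (row_mxEl (map_mx _ _)) !mxE dK.
exists i, (lshift _ a).
by rewrite /= /cone_dg row_mxEl ha; lia.
Qed.

Lemma min_res_reg_quot b (I : {mpoly k[n]} -> Prop) rho : min_res_reg b rho -> 
  (forall p, mideal b p <-> I p) -> is_reg_quot I rho%:Z.
Proof.
move=> [C [rC uC dC aC]] e; apply: resolves_reg (eq_resolves e rC) uC _ aC.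
by move=> i a; case/andP: (dC i a).
Qed.

End Regularity.

Section Hilbert.

Variable n : nat.
Implicit Types (b : pred 'X_{1..n}) (m mu : 'X_{1..n}) (W : {set 'I_n}).
Implicit Types (p q h : {poly int}).

Definition mons j : seq 'X_{1..n} :=
  [seq bmnm m | m : 'X_{1..n < j.+1} <- enum {: 'X_{1..n < j.+1}} & mdeg m == j].

Lemma mem_mons j m : (m \in mons j) = (mdeg m == j).
Proof.
apply/mapP/eqP => [[m']|e].
  by rewrite mem_filter => /andP[/eqP dm _ ->].
have lt : (mdeg m < j.+1)%N by rewrite e.
by exists (BMultinom lt); rewrite // mem_filter /= e eqxx mem_enum.
Qed.

Lemma uniq_mons j : uniq (mons j).
Proof.
rewrite map_inj_uniq; first by rewrite filter_uniq // enum_uniq.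
by move=> x y e; apply/val_inj.
Qed.

(** The value of the Hilbert function at j. *)
Definition std_count b j := count (predC b) (mons j).

Lemma std_count_add_multiple_lt mu b b' j : (j < mdeg mu)%N ->
  std_count (add_multiple mu b b') j = std_count b j.
Proof.
move=> lt; apply: eq_in_count => m; rewrite mem_mons => /eqP dm.
rewrite /= /add_multiple; case: (boolP (mu <= m)%MM) => [le|]; last by rewrite orbF.
have := mdegD (m - mu)%MM mu; rewrite submK // dm; lia.
Qed.

Lemma count_mons_mul mu (P : pred 'X_{1..n}) j :
  count (fun m => (mu <= m)%MM && P m) (mons (j + mdeg mu)) =
  count (fun m => P (mu + m)%MM) (mons j).
Proof.
rewrite -(count_map (fun m => mu + m)%MM).
rewrite -[LHS]size_filter -[RHS]size_filter; apply/perm_size/uniq_perm.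
- by rewrite filter_uniq ?uniq_mons.
- by rewrite filter_uniq // map_inj_uniq ?uniq_mons //; apply: addmI.
move=> m; rewrite !mem_filter mem_mons.
case Pm : (P m); rewrite ?andbF ?andbT //=.
apply/andP/mapP => [[le /eqP dm]|[m' + ->]].
  exists (m - mu)%MM; last by rewrite addmC submK.
  rewrite mem_mons; have := mdegD (m - mu)%MM mu; rewrite submK // dm; lia.
by rewrite mem_mons lem_addr mdegD addnC => /eqP ->.
Qed.

(** A standard monomial of I is lost in I + x^mu L exactly when it is x^mu m with m
    standard for I but not for L. *)
Lemma std_count_add_multiple mu b b' j : upclosed b -> subpred b b' ->
  (forall m, b (mu + m)%MM -> b m) ->
  (std_count (add_multiple mu b b') (j + mdeg mu) + std_count b j =
   std_count b (j + mdeg mu) + std_count b' j)%N.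
Proof.
move=> up sub reg.
set P := fun m => (mu <= m)%MM && (~~ b m && b' (m - mu)%MM).
have countD (P0 P1 P2 : pred 'X_{1..n}) s :
    (forall m, P0 m = P1 m + P2 m :> nat)%N -> (count P0 s = count P1 s + count P2 s)%N.
  by move=> e; elim: s => //= m s ->; rewrite e; lia.
have split1 : std_count b (j + mdeg mu) =
  (std_count (add_multiple mu b b') (j + mdeg mu) + count P (mons (j + mdeg mu)))%N.
  apply: countD => m; rewrite /= /add_multiple /P.
  by case: (b m); case: (mu <= m)%MM; case: (b' _).
have split2 : std_count b j = (count P (mons (j + mdeg mu)) + std_count b' j)%N.
  rewrite /P count_mons_mul; apply: countD => m; rewrite /= [(mu + m)%MM]addmC addmK.
  have -> : b (m + mu)%MM = b m.
    by apply/idP/idP; [rewrite addmC; apply: reg | rewrite addmC; apply: up].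
  by have := sub m; case: (b m); case: (b' m) => // /(_ isT).
by rewrite split1 [in LHS]split2; lia.
Qed.

(** Congruence modulo X^J: power series are handled through their truncations. *)
Definition eqmodX J p q := forall j, (j < J)%N -> p`_j = q`_j.

Lemma eqmodX_mull J r p q : eqmodX J p q -> eqmodX J (r * p) (r * q).
Proof.
move=> e j lt; rewrite !coefM; apply: eq_bigr => i _; congr (_ * _); apply: e.
exact: leq_ltn_trans (leq_subr _ _) lt.
Qed.

Lemma eqmodX_cancel J p q : eqmodX J ((1 - 'X) * p) ((1 - 'X) * q) -> eqmodX J p q.
Proof.
move=> e j; elim: j => [|j IH] lt; have := e _ lt;
  rewrite !mulrBl !mul1r !coefB !coefXM /=; first by rewrite !subr0.
by rewrite IH ?(ltnW lt) // => /addIr.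
Qed.

Definition hser b J : {poly int} := \poly_(j < J) (std_count b j)%:Z.

(** K is the numerator of the Hilbert series over the denominator (1 - t)^n. *)
Definition is_kpoly b (K : {poly int}) :=
  forall J, eqmodX J ((1 - 'X) ^+ n * hser b J) K.

Lemma hser_add_multiple mu b b' J : upclosed b -> subpred b b' ->
  (forall m, b (mu + m)%MM -> b m) ->
  eqmodX J (hser (add_multiple mu b b') J)
    ((1 - 'X^(mdeg mu)) * hser b J + 'X^(mdeg mu) * hser b' J).
Proof.
move=> up sub reg j lt.
rewrite mulrBl mul1r coefD coefB !coefXnM !coef_poly lt.
case: ltnP => le; first by rewrite std_count_add_multiple_lt // subr0 addr0.
have lt' : (j - mdeg mu < J)%N by exact: leq_ltn_trans (leq_subr _ _) lt.
rewrite lt'; have := std_count_add_multiple (j - mdeg mu) up sub reg.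
by rewrite subnK //; lia.
Qed.

Lemma is_kpoly_add_multiple mu b b' K K' : upclosed b -> subpred b b' ->
  (forall m, b (mu + m)%MM -> b m) -> is_kpoly b K -> is_kpoly b' K' ->
  is_kpoly (add_multiple mu b b') ((1 - 'X^(mdeg mu)) * K + 'X^(mdeg mu) * K').
Proof.
move=> up sub reg hK hK' J j lt.
rewrite (eqmodX_mull _ (hser_add_multiple up sub reg)) //.
rewrite mulrDr mulrCA [X in _ + X]mulrCA !coefD.
by congr (_ + _); apply: eqmodX_mull.
Qed.

Lemma eq_hser b b' J : b =1 b' -> hser b J = hser b' J.
Proof.
move=> e; apply/polyP=> i; rewrite !coef_poly; case: ifP => // _; congr (_%:Z).
by apply: eq_count => m; rewrite /= e.
Qed.

Lemma is_kpoly_ext b b' K : b =1 b' -> is_kpoly b K -> is_kpoly b' K.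
Proof. by move=> e hK J; rewrite -(eq_hser J e). Qed.

Lemma hser_unit J : hser predT J = 0.
Proof.
apply/polyP=> i; rewrite coef_poly coef0; case: ifP => // _.
by rewrite /std_count (eq_count (a2 := pred0)) ?count_pred0.
Qed.

Lemma is_kpoly_unit : is_kpoly predT 0.
Proof. by move=> J j _; rewrite hser_unit mulr0. Qed.

Lemma hser_var W J : eqmodX J (hser (var_pred W) J) ((1 - 'X) ^+ #|W| * hser pred0 J).
Proof.
rewrite -[W]set_enum; elim: (enum W) (enum_uniq W) => {W} [_|w s IH].
  have -> : [set x in [::]] = set0 :> {set 'I_n} by apply/setP=> x; rewrite !inE.
  by rewrite cards0 expr0 mul1r (eq_hser _ (@var_pred0 n)).
rewrite cons_uniq set_cons; set W := [set x in s] => /andP[ws /IH {}IH].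
have nWw : w \notin W by rewrite inE.
move=> j lt; rewrite -(eq_hser _ (var_predU1 w W)) hser_add_multiple //;
  [|exact: upclosed_var|by move=> m; apply: var_pred_mul].
rewrite hser_unit mulr0 addr0 mdeg1 expr1 cardsU1 nWw exprD -mulrA.
exact: (eqmodX_mull _ IH lt).
Qed.

(** Modulo all the variables only the monomial 1 is standard. Since killing a
    variable multiplies the series by 1 - t, this gives the series of the
    polynomial ring. *)
Lemma is_kpoly_zero : is_kpoly pred0 1.
Proof.
move=> J j lt; have := @hser_var setT J j lt; rewrite cardsT card_ord => <-.
rewrite coef_poly lt coef1 /std_count.
have h0 m : predC (var_pred setT) m = (m == 0%MM).
  apply/negP/eqP => [h|-> /var_predP[i _]]; last by rewrite mnm0E.
  apply/mnmP=> i; rewrite mnm0E; apply/eqP/negPn/negP=> mi; apply: h.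
  by apply/var_predP; exists i.
rewrite (eq_count h0) -/(count_mem 0%MM _) count_uniq_mem ?uniq_mons //.
by rewrite mem_mons mdeg0 eq_sym; case: eqP.
Qed.

Lemma is_kpoly_var W : is_kpoly (var_pred W) ((1 - 'X) ^+ #|W|).
Proof.
move=> J j lt; rewrite (eqmodX_mull _ (@hser_var W J)) // mulrCA.
by rewrite (eqmodX_mull _ (@is_kpoly_zero J)) // mulr1.
Qed.

(** Since 1 - t is invertible as a power series, a factor (1 - t)^c of the numerator
    cancels against the denominator. *)
Lemma kpoly_h b c h : (c <= n)%N -> is_kpoly b ((1 - 'X) ^+ c * h) ->
  forall j, h`_j = \sum_(i < j.+1) ((1 - 'X) ^+ (n - c) : {poly int})`_i
                                   * (std_count b (j - i))%:Z.
Proof.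
move=> le hK j.
have cancel d p q : eqmodX j.+1 ((1 - 'X) ^+ d * p) ((1 - 'X) ^+ d * q) ->
    eqmodX j.+1 p q.
  elim: d p q => [|d IH] p q; rewrite ?expr0 ?mul1r //.
  by rewrite exprSr -!mulrA => /IH/eqmodX_cancel.
have /cancel/(_ j (ltnSn _)) <- : eqmodX j.+1
    ((1 - 'X) ^+ c * ((1 - 'X) ^+ (n - c) * hser b j.+1)) ((1 - 'X) ^+ c * h).
  by rewrite mulrA -exprD subnKC //; apply: hK.
rewrite coefM; apply: eq_bigr => i _; rewrite coef_poly ltnS leq_subr //.
Qed.

(** The standard monomials form a basis of the quotient. *)
Lemma hilbert_fun_mideal (k : fieldType) b (I : {mpoly k[n]} -> Prop) :
  (forall p : {mpoly k[n]}, mideal b p <-> I p) -> is_hilbert_fun_quot I (std_count b).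
Proof.
move=> eI j; pose s := filter (predC b) (mons j).
have ss : size s = std_count b j by rewrite size_filter.
have us : uniq s by rewrite filter_uniq ?uniq_mons.
pose g (i : 'I_(std_count b j)) := nth 0%MM s i.
have gs i : g i \in s by rewrite mem_nth ?ss.
have gI : injective g.
  by move=> x y /eqP; rewrite nth_uniq ?ss // => /eqP/val_inj.
exists (fun i => 'X_[g i]); split=> [i|c /eI hc i|p /dhomogP hp].
- by rewrite dhomogX; have := gs i; rewrite mem_filter mem_mons => /andP[].
- have e : (\sum_(i < std_count b j) c i *: 'X_[k, g i])@_(g i) = c i.
    rewrite raddf_sum (bigD1 i) //= mcoeffZ mcoeffX eqxx mulr1 big1 ?addr0 // => x.
    move=> ne; rewrite mcoeffZ mcoeffX; case: eqP => [/gI e|_]; last by rewrite mulr0.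
    by rewrite e eqxx in ne.
  apply/eqP; rewrite -e mcoeff_eq0; apply/negP=> /hc.
  by rewrite unfold_in; have := gs i; rewrite mem_filter => /andP[/negbTE /= ->].
exists (fun i => p@_(g i)); apply/eI => m; rewrite unfold_in.
apply: contraLR => nb; rewrite -mcoeff_eq0 mcoeffB raddf_sum /=.
case: (boolP (m \in s)) => [/(nthP 0%MM)[i lt <-]|].
  rewrite ss in lt; rewrite -/(g (Ordinal lt)) (bigD1 (Ordinal lt)) //=.
  rewrite mcoeffZ mcoeffX eqxx mulr1 big1 ?addr0 ?subrr // => x ne.
  rewrite mcoeffZ mcoeffX; case: eqP => [/gI e|_]; last by rewrite mulr0.
  by rewrite e eqxx in ne.
rewrite mem_filter /= nb mem_mons => /= dm.
rewrite (memN_msupp_eq0 (p := p)) ?big1 ?subr0 // => [i _|].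
  rewrite mcoeffZ mcoeffX; case: eqP => [e|_]; last by rewrite mulr0.
  by move: dm; rewrite -e; have := gs i; rewrite mem_filter mem_mons => /andP[_ ->].
by apply: contra dm => /hp ->.
Qed.

End Hilbert.

(** * Krull dimension *)

Section KrullDimension.

Variables (k : fieldType) (n : nat).
Local Notation R := {mpoly k[n]}.
Implicit Types (C : nat -> R -> Prop) (f : nat -> R) (W : {set 'I_n}).

Lemma ideal_sum I (T : Type) (s : seq T) (P : pred T) (F : T -> R) : is_ideal I ->
  (forall i, P i -> I (F i)) -> I (\sum_(i <- s | P i) F i).
Proof. by move=> [I0 ID _] h; apply: big_ind. Qed.

Lemma prime_cancel_exp (P : R -> Prop) g t p :
  is_prime_ideal P -> ~ P g -> P (g ^+ t * p) -> P p.
Proof.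
move=> [_ _ prP] nf; elim: t => [|t IH]; first by rewrite mul1r.
by rewrite exprS -mulrA => /prP[//|/IH].
Qed.

Lemma msupp_le_mul d e (p q : R) : {in msupp p, forall m, (mdeg m <= d)%N} ->
  {in msupp q, forall m, (mdeg m <= e)%N} ->
  {in msupp (p * q), forall m, (mdeg m <= d + e)%N}.
Proof.
move=> hp hq m /msuppM_le/allpairsP[[m1 m2] /= [/hp h1 /hq h2 ->]].
by rewrite mdegD leq_add.
Qed.

Section Box.

Variable N : nat.

(** Exponent vectors of length l with entries below N; the recursive encoding lets the
    first exponent be split off. *)
Fixpoint box l : finType := if l is j.+1 then ('I_N * box j)%type else unit.

Fixpoint box_prod l f : box l -> R :=
  if l is j.+1 then fun x => f 0%N ^+ x.1 * box_prod (fun i => f i.+1) x.2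
  else fun=> 1.

Lemma card_box l : #|box l| = (N ^ l)%N.
Proof.
by elim: l => [|l IH]; rewrite /= ?card_unit // card_prod card_ord IH expnS.
Qed.

(** Peeling off one power of f_0 at a time: modulo C_1 only the terms without f_0
    survive, and these are handled by the shorter chain; the remaining sum is
    divisible by f_0, which can be cancelled because C_0 is prime. *)
Lemma chain_independent l C f :
  (forall i, (i <= l)%N -> is_prime_ideal (C i)) ->
  (forall i, (i < l)%N -> [/\ sub_ideal (C i) (C i.+1), C i.+1 (f i) & ~ C i (f i)]) ->
  forall v : box l -> k, C 0%N (\sum_x v x *: box_prod f x) -> forall x, v x = 0.
Proof.
elim: l C f => [|l IH] C f prC chC v.
  have [[_ _ mC] nC1 _] := prC 0%N (leqnn _).
  rewrite (bigD1 tt) //= big1 ?addr0 => [h [] | []] //.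
  apply/eqP; apply: contra_notT nC1 => v0.
  have := mC ((v tt)^-1)%:MP _ h; rewrite mul_mpolyC scalerA mulVf //.
  by rewrite scale1r.
pose f' i := f i.+1.
pose g (t : 'I_N) := \sum_y v (t, y) *: box_prod f' y.
have -> : \sum_x v x *: box_prod f x = \sum_(t < N) f 0%N ^+ t * g t.
  transitivity (\sum_(x : 'I_N * box l)
      v (x.1, x.2) *: (f 0%N ^+ x.1 * box_prod f' x.2)).
    by apply: eq_bigr => -[].
  rewrite -(pair_bigA _
    (fun (t : 'I_N) y => v (t, y) *: (f 0%N ^+ t * box_prod f' y))) /=.
  apply: eq_bigr => t _; rewrite mulr_sumr.
  by apply: eq_bigr => y _; rewrite scalerAr.
move=> h.
have [sub01 f1 nf0] := chC 0%N isT.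
have [idC1 _ _] := prC 1%N isT; have [C10 C1D C1M] := idC1.
have g0 t : C 1%N (g t) -> forall y, v (t, y) = 0.
  apply: (IH (fun i => C i.+1) f') => i lt; [exact: prC | exact: chC].
have claim T : (T <= N)%N -> forall (t : 'I_N) y, (t < T)%N -> v (t, y) = 0.
  elim: T => [|T IHT] // lt t y; rewrite ltnS leq_eqVlt => /orP[/eqP tT|]; last first.
    by apply: IHT; apply: ltnW.
  apply: g0; move: h; rewrite (bigID (fun s : 'I_N => (s < T)%N)) /= big1 ?add0r.
    rewrite (eq_bigr (fun s : 'I_N => f 0%N ^+ T * (f 0%N ^+ (s - T) * g s))).
      rewrite -mulr_sumr => /(prime_cancel_exp (prC 0%N isT) nf0)/sub01.
      rewrite (bigD1 t) /= ?tT ?ltnn // subnn mul1r => hC.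
      suff hr : C 1%N
          (-1 * \sum_(i < N | ~~ (i < T)%N && (i != t)) f 0%N ^+ (i - T) * g i).
        by have := C1D _ _ hC hr; rewrite mulN1r addrK.
      apply: (C1M); apply: ideal_sum => // i /andP[iT it].
      have : (0 < i - T)%N.
        rewrite subn_gt0 ltn_neqAle leqNgt iT andbT; apply: contra it => /eqP e.
        by apply/eqP/val_inj; rewrite /= tT.
      case: (i - T)%N => // u _.
      by rewrite exprS -mulrA mulrC; apply: C1M.
    by move=> s sT; rewrite mulrA -exprD subnKC // leqNgt.
  move=> s sT; rewrite /g big1 ?mulr0 // => z _.
  by rewrite IHT ?scale0r // ltnW.
by move=> [t y]; apply: (claim N).
Qed.

Lemma box_prod_deg l E f : 
  (forall i, (i < l)%N -> {in msupp (f i), forall m, (mdeg m <= E)%N}) ->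
  forall x : box l, {in msupp (box_prod f x), forall m, (mdeg m <= l * (N * E))%N}.
Proof.
elim: l f => [|l IH] f hf x.
  by move=> m /=; rewrite msupp1 inE => /eqP ->; rewrite mdeg0.
rewrite mulSn /=; apply: msupp_le_mul; last by apply: IH => i lt; apply: hf.
have le : (x.1 <= N)%N by apply: ltnW.
have ht t : {in msupp (f 0%N ^+ t), forall m, (mdeg m <= t * E)%N}.
  elim: t => [|t IHt]; first by move=> m; rewrite msupp1 inE => /eqP ->; rewrite mdeg0.
  by rewrite exprS mulSn; apply: msupp_le_mul => //; apply: hf.
by move=> m /ht dm; apply: leq_trans dm _; rewrite leq_mul2r le orbT.
Qed.

End Box.

Lemma linear_dependence (A B : finType) (M : A -> B -> k) : (#|B| < #|A|)%N ->
  exists2 v : A -> k, (exists x, v x != 0) & forall y, \sum_x v x * M x y = 0.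
Proof.
move=> lt; pose X := \matrix_(i < #|A|, j < #|B|) M (enum_val i) (enum_val j).
have /rowV0Pn[w wX /rV0Pn[i wi]] : kermx X != 0.
  rewrite -mxrank_eq0 mxrank_ker subn_eq0 -ltnNge.
  exact: leq_ltn_trans (rank_leq_col X) lt.
exists (fun x => w ord0 (enum_rank x)); first by exists (enum_val i); rewrite enum_valK.
move=> y; have /rowP/(_ (enum_rank y)) := sub_kermxP wX.
rewrite !mxE => h; rewrite -[RHS]h (reindex (@enum_val A predT)) /=; last first.
  by exists enum_rank => x _; rewrite ?enum_rankK ?enum_valK.
by apply: eq_bigr => j _; rewrite mxE enum_valK enum_rankK.
Qed.

Lemma mideal_var_sub W (P : R -> Prop) p : is_ideal P ->
  (forall i, i \in W -> P 'X_i) -> mideal (var_pred W) p -> P p.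
Proof.
move=> idP hW hp; rewrite [p]mpolyE big_seq; apply: ideal_sum => // m /hp.
rewrite unfold_in => /var_predP[i /hW Pi mi].
have [_ _ PM] := idP.
have le : (U_(i) <= m)%MM by rewrite lep1mP.
by rewrite -(submK le) mpolyXD scalerAl; apply: PM.
Qed.

(** Were the chain longer than the number s of variables outside W, the products
    of powers below N of s + 1 elements witnessing the strict inclusions would be
    N^(s+1) independent elements of a space of dimension O(N^s). *)
Lemma prime_chain_le I l C W : prime_chain I l C ->
  (forall i, i \in W -> C 0%N 'X_i) -> (l <= #|~: W|)%N.
Proof.
move=> [prC chC] hW; rewrite leqNgt; apply/negP; set s := #|~: W| => lt.
have [f hf] : exists f, forall i, (i < l)%N -> C i.+1 (f i) /\ ~ C i (f i).
  exists (fun i => if excluded_middle_informative (exists p, C i.+1 p /\ ~ C i p)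
    is left h then sval (constructive_indefinite_description _ h) else 0) => i lti.
  case: excluded_middle_informative => [h|[]].
    by case: constructive_indefinite_description.
  by have [_ [p Cp nCp]] := chC i lti; exists p.
have [E hE] : exists E, forall i, (i < l)%N ->
    {in msupp (f i), forall m, (mdeg m <= E)%N}.
  exists (\max_(i < l) msize (f i)) => i lti m /msize_mdeg_lt/ltnW h.
  exact: leq_trans h (leq_bigmax (Ordinal lti)).
(* N is chosen to make N^(s+1) exceed the number (B+1)^s of monomials of degree at
   most B in the s variables outside W. *)
pose N := ((s.+1 * E).+1 ^ s).+1.
pose B := (s.+1 * (N * E))%N.
pose U := pffun_on (ord0 : 'I_B.+1) (~: W) predT.
pose mon (u : {ffun 'I_n -> 'I_B.+1}) := [multinom (u i : nat) | i < n].
have [|v [x vx] hv] := @linear_dependence (box N s.+1) {u | u \in U}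
  (fun x u => (box_prod f x)@_(mon (val u))).
  rewrite card_box card_sig card_pffun_on card_ord -/s /N expnS.
  have le : (B.+1 <= N * (s.+1 * E).+1)%N.
    by rewrite /B mulnS mulnCA addnC -addn1 leq_add2l.
  have {}le : (B.+1 ^ s <= (N * (s.+1 * E).+1) ^ s)%N.
    by case: (s) le => // t; rewrite leq_exp2r.
  apply: leq_ltn_trans le _.
  by rewrite expnMn mulnC ltn_mul2r expn_gt0 /= ltnS.
move/eqP: vx; apply; apply: (chain_independent (l := s.+1) (C := C) (f := f)).
- by move=> i lei; case: (prC i (leq_trans lei lt)).
- move=> i lti; have lti' := leq_trans lti lt; have [] := hf i lti'.
  by case: (chC i lti').
have [[idC _ _] _] := prC 0%N isT.
apply: mideal_var_sub idC hW _ => m hm.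
case: (boolP (var_pred W m)) => // nm; move: hm; rewrite mcoeff_msupp => /eqP[].
rewrite raddf_sum /=; under eq_bigr do rewrite mcoeffZ.
have [le|gt] := leqP (mdeg m) B; last first.
  rewrite big1 // => y _; rewrite memN_msupp_eq0 ?mulr0 //; apply/negP=> hm.
  have := box_prod_deg (fun i lti => hE i (leq_trans lti lt)) hm.
  by rewrite leqNgt gt.
have lem i : (m i <= B)%N.
  by apply: leq_trans le; rewrite mdegE (bigD1 i) //= leq_addr.
pose u : {ffun 'I_n -> 'I_B.+1} := [ffun i => inord (m i)].
have uU : u \in U.
  apply/pffun_onP; split=> //; apply/subsetP=> i; rewrite !inE ffunE.
  apply: contra => Wi; apply/eqP/val_inj; rewrite /= inordK ?ltnS //.
  by apply/eqP; apply: contraNT nm => mi; apply/var_predP; exists i.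
rewrite -[RHS](hv (exist _ u uU)); apply: eq_bigr => y _; congr (_ * _@_ _).
by apply/mnmP=> i; rewrite mnmE ffunE inordK ?ltnS.
Qed.

(** The ideal generated by the variables in W is prime because it is the kernel of
    the endomorphism of R that sends them to 0. *)
Definition kill_vars W : n.-tuple R := [tuple if i \in W then 0 else 'X_i | i < n].

Lemma kill_varsX W m :
  'X_[m] \mPo kill_vars W = if var_pred W m then 0 else 'X_[m].
Proof.
rewrite comp_mpolyX; case: ifP => [/var_predP[i Wi mi]|/negbT nm].
  by rewrite (bigD1 i) //= tnth_mktuple Wi expr0n (negbTE mi) mul0r.
rewrite [RHS]mpolyXE_id; apply: eq_bigr => i _; rewrite tnth_mktuple.
case: ifP => // Wi; suff -> : m i = 0%N by [].
by apply/eqP; apply: contraNT nm => mi; apply/var_predP; exists i.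
Qed.

Lemma kill_vars_eq0 W p : mideal (var_pred W) p <-> p \mPo kill_vars W = 0.
Proof.
split=> [hp|/mpolyP h m hm].
  rewrite comp_mpolyEX big_seq big1 // => m /hp; rewrite unfold_in kill_varsX.
  by rewrite /var_pred => ->; rewrite scaler0.
case: (boolP (var_pred W m)) => // nm; have := h m.
rewrite mcoeff0 comp_mpolyEX raddf_sum /= (bigD1_seq m) ?msupp_uniq //=.
rewrite mcoeffZ kill_varsX (negbTE nm) mcoeffX eqxx mulr1 big1 ?addr0.
  by move/eqP; rewrite mcoeff_eq0 hm.
move=> m' ne; rewrite mcoeffZ kill_varsX; case: ifP => _.
  by rewrite mcoeff0 mulr0.
by rewrite mcoeffX (negbTE ne) mulr0.
Qed.

Lemma prime_var W : is_prime_ideal (mideal (k := k) (var_pred W)).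
Proof.
split; first exact/mideal_ideal/upclosed_var.
  move=> /(_ 0%MM); rewrite msupp1 mem_head => /(_ isT).
  by rewrite unfold_in => /var_predP[i _]; rewrite mnm0E.
move=> p q /kill_vars_eq0; rewrite rmorphM => /eqP.
by rewrite mulf_eq0 => /orP[] /eqP h; [left | right]; apply/kill_vars_eq0.
Qed.

(** The ideals obtained by adjoining the variables outside W one at a time. *)
Lemma var_chain I W : sub_ideal I (mideal (var_pred W)) ->
  exists C, prime_chain I #|~: W| C.
Proof.
move=> IW; pose s := enum (~: W); pose A i := W :|: [set x in take i s].
have subA (A1 A2 : {set 'I_n}) : A1 \subset A2 ->
    sub_ideal (mideal (k := k) (var_pred A1)) (mideal (var_pred A2)).
  move=> /subsetP h p hp m /hp; rewrite !unfold_in => /var_predP[i /h Ai mi].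
  by apply/var_predP; exists i.
exists (fun i => mideal (var_pred (A i))); split=> i lei.
  split; first exact: prime_var.
  by move=> p /IW; apply: subA; apply: subsetUl.
rewrite cardE -/s in lei.
have [x0 _] : exists x0 : 'I_n, true by case: (s) lei => // x t _; exists x.
split.
  apply: subA; apply: setUS; apply/subsetP=> x; rewrite !inE (take_nth x0) //.
  by rewrite mem_rcons inE orbC => ->.
exists 'X_(nth x0 s i).
  move=> m /mem_msuppXP <-; apply/var_predP; exists (nth x0 s i).
    by rewrite !inE (take_nth x0) // mem_rcons mem_head orbT.
  by rewrite mnm1E eqxx.
move=> /(_ U_(nth x0 s i)%MM); rewrite msuppX mem_head => /(_ isT).
rewrite unfold_in => /var_predP[x Ax]; rewrite mnm1E.
case: (eqVneq (nth x0 s i) x) => // e _.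
move: Ax; rewrite -e !inE => /orP[Wx|].
  by have := mem_nth x0 lei; rewrite mem_enum inE Wx.
by rewrite in_take ?mem_nth // index_uniq ?enum_uniq // ltnn.
Qed.

End KrullDimension.

(** * Edge ideals *)

Section Graphs.

Variable k : fieldType.

Section EdgePred.

Variable n : nat.
Implicit Types (e : rel 'I_n) (W C : {set 'I_n}) (m : 'X_{1..n}) (h : {poly int}).

Definition edge_pred e : pred 'X_{1..n} :=
  fun m => [exists i, exists j, [&& e i j, m i != 0%N & m j != 0%N]].

Lemma edge_predP e m :
  reflect (exists i j, [/\ e i j, m i != 0%N & m j != 0%N]) (edge_pred e m).
Proof.
apply: (iffP existsP) => [[i /existsP[j /and3P[]]]|[i [j [eij mi mj]]]].
  by exists i, j.
by exists i; apply/existsP; exists j; rewrite eij mi.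
Qed.

Lemma upclosed_edge e : upclosed (edge_pred e).
Proof.
move=> m m' /edge_predP[i [j [eij mi mj]]]; apply/edge_predP; exists i, j.
by rewrite !mnmDE !addn_eq0 !negb_and mi mj !orbT.
Qed.

Definition cover e C := forall i j, e i j -> (i \in C) || (j \in C).

Lemma cover_edge_pred e C : cover e C -> subpred (edge_pred e) (var_pred C).
Proof.
move=> cC m /edge_predP[i [j [/cC/orP[Ci|Cj] mi mj]]]; apply/var_predP;
  by [exists i | exists j].
Qed.

Lemma edge_pred_mul e (m0 m : 'X_{1..n}) :
  (forall i j, e i j -> m0 i = 0%N /\ m0 j = 0%N) ->
  edge_pred e (m0 + m)%MM -> edge_pred e m.
Proof.
move=> h /edge_predP[i [j [eij mi mj]]]; apply/edge_predP; exists i, j.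
by move: mi mj; rewrite !mnmDE; case: (h i j eij) => -> ->.
Qed.

(** The vertices a, a + 1, ... are isolated, hence free for the next construction, and
    C is a minimum vertex cover, whose size is the height of the edge ideal. *)
Definition realizes a rho h e C :=
  [/\ [/\ ssrbool.symmetric e, irreflexive e & forall i j, e i j -> (i < a)%N],
      [/\ forall i, i \in C -> (i < a)%N, cover e C
        & forall C', cover e C' -> (#|C| <= #|C'|)%N],
      min_res_reg k (edge_pred e) rho
    & is_kpoly (edge_pred e) ((1 - 'X) ^+ #|C| * h)].

Lemma cover_sub e e' C : subrel e e' -> cover e' C -> cover e C.
Proof. by move=> s c i j /s/c. Qed.

Lemma coverD1 e C z : (forall i j, e i j -> i != z /\ j != z) -> cover e C ->
  cover e (C :\ z).
Proof. by move=> nz c i j eij; rewrite !inE; case: (nz i j eij) => -> ->; apply: c. Qed.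

Definition add_edge e u v : rel 'I_n :=
  fun x y => [|| e x y, (x == u) && (y == v) | (x == v) && (y == u)].

Lemma edge_pred_add_edge e u v : u != v -> 
  add_multiple (U_(u) + U_(v))%MM (edge_pred e) predT =1 edge_pred (add_edge e u v).
Proof.
move=> uv m; rewrite /add_multiple andbT.
have -> : (U_(u) + U_(v) <= m)%MM = (m u != 0%N) && (m v != 0%N).
  apply/mnm_lepP/andP => [h|[mu mv] i].
    split; [have := h u | have := h v]; rewrite mnmDE !mnm1E eqxx; first by lia.
    by rewrite addn1; lia.
  rewrite mnmDE !mnm1E.
  case: (eqVneq u i) => [<-|_]; first by rewrite eq_sym (negbTE uv) addn0 lt0n.
  by case: (eqVneq v i) => [<-|]//; rewrite add0n lt0n.
apply/orP/edge_predP => [[/edge_predP[i [j [eij mi mj]]]|/andP[mu mv]]|].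
- by exists i, j; rewrite /add_edge eij.
- by exists u, v; rewrite /add_edge !eqxx orbT.
case=> i [j [/or3P[eij|/andP[/eqP-> /eqP->]|/andP[/eqP-> /eqP->]] mi mj]].
- by left; apply/edge_predP; exists i, j.
- by right; rewrite mi mj.
- by right; rewrite mi mj.
Qed.

(** The quadric is regular modulo the old edge ideal, so the numerator is multiplied by
    1 - t^2, one factor 1 - t of which goes into the larger height. *)
Lemma realizes_add_edge a rho h e C (u v : 'I_n) : u = a :> nat -> v = a.+1 :> nat ->
  realizes a rho h e C ->
  realizes a.+2 rho.+1 (h * (1 + 'X)) (add_edge e u v) (u |: C).
Proof.
move=> ua va [[sym irr lt] [Clt cC minC] reg kp].
have ltr i j : e i j -> (j < a)%N by rewrite sym; apply: lt.
have uv : u != v by apply/eqP=> /(congr1 val) /=; lia.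
have nCu : u \notin C by apply/negP=> /Clt; lia.
have neq (x i : 'I_n) : (a <= x)%N -> (i < a)%N -> i != x.
  by move=> ax ia; apply/eqP=> ix; rewrite ix in ia; lia.
have un i j : e i j -> i != u /\ j != u.
  by move=> eij; rewrite !neq ?(lt i j) ?(ltr i j) // ua.
have vn i j : e i j -> i != v /\ j != v.
  by move=> eij; rewrite !neq ?(lt i j) ?(ltr i j) // va leqnSn.
have regular m : edge_pred e (U_(u) + U_(v) + m)%MM -> edge_pred e m.
  apply: edge_pred_mul => i j eij; rewrite !mnmDE !mnm1E.
  by case: (un i j eij) (vn i j eij) => /negbTE iu /negbTE ju [/negbTE iv /negbTE jv];
    rewrite ![u == _]eq_sym ![v == _]eq_sym iu ju iv jv.
have deg2 : mdeg (U_(u) + U_(v))%MM = 2%N by rewrite mdegD !mdeg1.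
split.
- split=> [x y|x|x y].
  + by rewrite /add_edge sym; case: (e y x) => //=; rewrite orbC ![_ && (x == _)]andbC.
  + rewrite /add_edge irr /=; case: (eqVneq x u) => [->|_] /=.
      by rewrite (negbTE uv).
    by rewrite andbF.
  by case/or3P=> [/lt|/andP[/eqP-> _]|/andP[/eqP-> _]]; lia.
- split=> [i|i j|C' cC'].
  + by rewrite !inE => /orP[/eqP->|/Clt]; lia.
  + rewrite !inE; case/or3P=> [/cC/orP[]->|/andP[/eqP-> _]|/andP[_ /eqP->]];
      by rewrite ?eqxx ?orbT.
  rewrite cardsU1 nCu.
  have cC1 : cover e C' by apply: cover_sub cC' => x y; rewrite /add_edge => ->.
  have /cC'/orP[uC|vC] : add_edge e u v u v by rewrite /add_edge !eqxx orbT.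
    by rewrite (cardsD1 u C') uC leq_add2l; apply/minC/coverD1.
  by rewrite (cardsD1 v C') vC leq_add2l; apply/minC/coverD1.
- apply: min_res_reg_ext (edge_pred_add_edge e uv) _.
  by apply: min_res_reg_quadric reg => //; apply: upclosed_edge.
apply: is_kpoly_ext (edge_pred_add_edge e uv) _.
have := is_kpoly_add_multiple (@upclosed_edge e) (fun _ _ => isT) regular kp
  (@is_kpoly_unit n).
have -> : #|u |: C| = #|C|.+1 by rewrite cardsU1 nCu.
by rewrite deg2; congr is_kpoly; rewrite [(1 - 'X) ^+ _.+1]exprS; ring.
Qed.

Definition add_star e z W : rel 'I_n :=
  fun x y => [|| e x y, (x == z) && (y \in W) | (y == z) && (x \in W)].

Lemma edge_pred_add_star e z W : z \notin W ->
  add_multiple U_(z)%MM (edge_pred e) (var_pred W) =1 edge_pred (add_star e z W).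
Proof.
move=> nzW m; rewrite /add_multiple lep1mP.
have sub w : w \in W -> (m - U_(z))%MM w = m w.
  move=> Ww; rewrite mnmBE mnm1E; case: (eqVneq z w) => [e1|]; last by rewrite subn0.
  by rewrite e1 Ww in nzW.
apply/orP/edge_predP => [[/edge_predP[i [j [eij mi mj]]]|]|].
- by exists i, j; rewrite /add_star eij.
- case/andP=> mz /var_predP[w Ww]; rewrite sub // => mw.
  by exists z, w; rewrite /add_star eqxx Ww orbT.
case=> i [j [/or3P[eij|/andP[/eqP-> Wj]|/andP[/eqP-> Wi]] mi mj]].
- by left; apply/edge_predP; exists i, j.
- by right; rewrite mi; apply/var_predP; exists j; rewrite ?sub.
- by right; rewrite mj; apply/var_predP; exists i; rewrite ?sub.
Qed.

(** Joining a new vertex z to a minimum cover C and b + 1 further new vertices B adds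
    the ideal x_z (C + B) to the edge ideal I, which is contained in (C). The numerator
    becomes (1 - t) K + t (1 - t)^(|C| + b + 1), where K = (1 - t)^|C| h. A cover
    that avoids z contains C and B, so it is not smaller than C + z. *)
Lemma realizes_add_star a b rho h e C (z : 'I_n) (B : {set 'I_n}) : z = a :> nat ->
  (forall i, i \in B -> (a < i < a + b.+2)%N) -> #|B| = b.+1 ->
  realizes a rho h e C ->
  realizes (a + b.+2) (maxn rho 1) (h + 'X * (1 - 'X) ^+ b)
    (add_star e z (C :|: B)) (z |: C).
Proof.
move=> za ltB cB [[sym irr lt] [Clt cC minC] reg kp]; set W := C :|: B.
have ltr i j : e i j -> (j < a)%N by rewrite sym; apply: lt.
have zn i j : e i j -> i != z /\ j != z.
  move=> eij; split; apply/eqP=> e1; [have := lt i j eij | have := ltr i j eij];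
    by rewrite e1; lia.
have nCz : z \notin C by apply/negP=> /Clt; lia.
have nBz : z \notin B by apply/negP=> /ltB; lia.
have nWz : z \notin W by rewrite inE negb_or nCz.
have cardW : #|W| = (#|C| + b.+1)%N.
  rewrite cardsU cB (_ : C :&: B = set0) ?cards0 ?subn0 //.
  apply/setP=> i; rewrite !inE; apply/negP=> /andP[/Clt + /ltB]; lia.
have W0 : W != set0 by rewrite -card_gt0 cardW addnS.
have cW : cover e W by move=> i j /cC; rewrite !inE => /orP[]->; rewrite ?orbT.
have regular m : edge_pred e (U_(z) + m)%MM -> edge_pred e m.
  apply: edge_pred_mul => i j /zn[/negbTE iz /negbTE jz].
  by rewrite !mnm1E ![z == _]eq_sym iz jz.
split.
- split=> [x y|x|x y].
  + by rewrite /add_star sym; case: (e y x) => //=; rewrite orbC.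
  + rewrite /add_star irr /=; case: (eqVneq x z) => [->|_] //=.
    by rewrite (negbTE nWz).
  case/or3P=> [/lt|/andP[/eqP-> _]|/andP[_]]; [lia | lia|].
  by rewrite !inE => /orP[/Clt|/ltB]; lia.
- split=> [i|i j|C' cC'].
  + by rewrite !inE => /orP[/eqP->|/Clt]; lia.
  + rewrite !inE; case/or3P=> [/cC/orP[]->|/andP[/eqP-> _]|/andP[/eqP-> _]];
      by rewrite ?eqxx ?orbT.
  rewrite cardsU1 nCz.
  have cC1 : cover e C' by apply: cover_sub cC' => x y; rewrite /add_star => ->.
  case: (boolP (z \in C')) => zC'.
    by rewrite (cardsD1 z C') zC' leq_add2l; apply/minC/coverD1.
  have /subset_leq_card : W \subset C'.
    apply/subsetP=> w Ww; have /cC' : add_star e z W z w.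
      by rewrite /add_star eqxx Ww orbT.
    by rewrite (negbTE zC').
  by rewrite cardW; lia.
- apply: min_res_reg_ext (edge_pred_add_star e nWz) _.
  apply: min_res_reg_suspension reg => //; first exact: upclosed_edge.
  exact: cover_edge_pred.
apply: is_kpoly_ext (edge_pred_add_star e nWz) _.
have := is_kpoly_add_multiple (@upclosed_edge e) (cover_edge_pred cW) regular kp
  (@is_kpoly_var n W).
have -> : #|z |: C| = #|C|.+1 by rewrite cardsU1 nCz.
rewrite mdeg1 cardW addnS; congr is_kpoly.
by rewrite ![(1 - 'X) ^+ _.+1]exprS exprD; ring.
Qed.

End EdgePred.

(** The ambient ring is as large as one likes: all the graphs of a construction live
    on the same vertices, so that no change of rings is needed. *)
Definition realizable rho h := exists a, forall n, (a <= n)%N ->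
  exists (e : rel 'I_n) C, realizes a rho h e C.

Lemma realizable0 : realizable 0 1.
Proof.
exists 0%N => n _; exists (fun _ _ => false), set0; split.
- by [].
- by split=> [i|//|C' _]; rewrite ?inE ?cards0.
- by apply: min_res_reg_ext (min_res_reg0 k n) => m; apply/esym/edge_predP => -[i [j []]].
rewrite cards0 mulr1; apply: is_kpoly_ext (@is_kpoly_zero n) => m.
by apply/esym/edge_predP => -[i [j []]].
Qed.

Lemma realizable_edge rho h : realizable rho h -> realizable rho.+1 (h * (1 + 'X)).
Proof.
move=> [a ha]; exists a.+2 => n len.
have [e [C r]] := ha n (ltnW (ltnW len)).
exists (add_edge e (Ordinal (ltnW len)) (Ordinal len)); eexists.
exact: realizes_add_edge r.
Qed.

Lemma realizable_star b rho h : realizable rho h ->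
  realizable (maxn rho 1) (h + 'X * (1 - 'X) ^+ b).
Proof.
move=> [a ha]; exists (a + b.+2)%N => n len.
have [|e [C r]] := ha n; first by apply: leq_trans len; apply: leq_addr.
have lta : (a < n)%N by lia.
have ltB (i : 'I_b.+1) : (a.+1 + i < n)%N by have := ltn_ord i; lia.
pose B := [set Ordinal (ltB i) | i in 'I_b.+1].
exists (add_star e (Ordinal lta) (C :|: B)); eexists; apply: realizes_add_star r => //.
  by move=> i /imsetP[j _ ->] /=; have := ltn_ord j; lia.
rewrite card_imset ?card_ord // => i j /(congr1 val) /= /addnI; exact: val_inj.
Qed.

Lemma realizable_edges t rho h : realizable rho h ->
  realizable (rho + t) (h * (1 + 'X) ^+ t).
Proof.
move=> r; elim: t => [|t IH]; first by rewrite addn0 mulr1.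
by rewrite addnS exprSr mulrA; apply: realizable_edge.
Qed.

(** From 1 + Nt a disjoint edge gives 1 + (N + 1)t + Nt^2, and N stars, each
    contributing t(1 - t), remove the quadratic term. *)
Lemma realizable_linear rho :
  exists2 N, (0 < N)%N & realizable rho.+1 (1 + 'X *+ N).
Proof.
elim: rho => [|rho [N N0 r]].
  exists 1%N => //; rewrite mulr1n -[1 + 'X]mul1r.
  exact: realizable_edge realizable0.
exists (N.*2.+1) => //.
have step t : realizable rho.+2 ((1 + 'X *+ N) * (1 + 'X) + ('X * (1 - 'X)) *+ t).
  elim: t => [|t IH]; first by rewrite addr0; apply: realizable_edge.
  by rewrite mulrS addrCA addrC; apply: (@realizable_star 1 rho.+2).
have := step N; congr realizable.
rewrite -(mulr_natr 'X N) -(mulr_natr 'X N.*2.+1) -(mulr_natr (_ * _) N).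
by rewrite -[N.*2.+1]addn1 -addnn !natrD; ring.
Qed.

Lemma mideal_edge_ideal (G : sgraph) p :
  mideal (edge_pred (@edge G)) p <-> edge_ideal k G p.
Proof.
split=> [hp|[N [a [g [hg ->]]]]]; last first.
  have [I0 ID IM] := mideal_ideal k (@upclosed_edge _ (@edge G)).
  apply: (big_ind (mideal (edge_pred (@edge G)))) => // t _; apply: (IM).
  have [i [j [eij ->]]] := hg t; rewrite -mpolyXD => m /mem_msuppXP <-.
  apply/edge_predP; exists i, j; split=> //.
    by rewrite mnmDE mnm1E eqxx.
  by rewrite mnmDE !mnm1E eqxx addn1.
pose m t := tnth (in_tuple (msupp p)) t.
have ex t : exists ij : 'I_(nvert G) * 'I_(nvert G),
    edge ij.1 ij.2 /\ (U_(ij.1) + U_(ij.2) <= m t)%MM.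
  have /hp : m t \in msupp p by exact: mem_tnth.
  rewrite unfold_in => /edge_predP[i [j [eij mi mj]]].
  exists (i, j); split=> //=; apply/mnm_lepP => x; rewrite mnmDE !mnm1E.
  have ij : i != j by apply: contraTneq eij => ->; rewrite edge_irr.
  case: (eqVneq i x) => [<-|_]; first by rewrite eq_sym (negbTE ij) addn0 lt0n.
  by case: (eqVneq j x) => [<-|]//; rewrite add0n lt0n.
have [F hF] := fin_all_exists ex.
exists (size (msupp p)), (fun t => p@_(m t) *: 'X_[m t - (U_((F t).1) + U_((F t).2))]),
  (fun t => 'X_((F t).1) * 'X_((F t).2)); split=> [t|].
  by exists (F t).1, (F t).2; case: (hF t).
rewrite {1}[p]mpolyE big_tnth; apply: eq_bigr => t _.
by rewrite -mpolyXD -scalerAl -mpolyXD submK //; case: (hF t).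
Qed.

(** A prime containing the edge ideal contains one end of every edge, so the variables
    in it form a cover; hence the dimension is the number of vertices outside a minimum
    cover. *)
Lemma realizable_graph rho h : realizable rho h -> h.[1] <> 0 ->
  exists G, is_reg_quot (edge_ideal k G) rho%:Z /\ is_h_poly_quot (edge_ideal k G) h.
Proof.
move=> [n /(_ n (leqnn n))[e [C [[sym irr _] [_ cC minC] reg kp]]]] h1.
exists (SGraph sym irr).
have eI := @mideal_edge_ideal (SGraph sym irr).
split; first exact: min_res_reg_quot reg eI.
exists (std_count (edge_pred e)), (n - #|C|)%N; split=> //.
- exact: hilbert_fun_mideal eI.
- have cardC (A : {set 'I_n}) : #|~: A| = (n - #|A|)%N by rewrite cardsCs setCK card_ord.
  split.
    rewrite -cardC; apply: var_chain => p /eI hp m /hp.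
    by rewrite !unfold_in; apply: cover_edge_pred.
  move=> l P chP.
  pose W := [set i | if excluded_middle_informative (P 0%N ('X_i : {mpoly k[n]}))
                     then true else false].
  have WP i : (i \in W) <-> P 0%N 'X_i.
    by rewrite inE; case: excluded_middle_informative.
  apply: leq_trans (prime_chain_le chP (fun i => (WP i).1)) _.
  rewrite cardC; apply/leq_sub2l/minC => i j eij.
  have [[_ _ prP] IP] := (chP.1 0%N isT).
  have /prP[/WP->|/WP->] : P 0%N ('X_i * 'X_j); rewrite ?orbT //.
  apply/IP/eI; rewrite -mpolyXD => m /mem_msuppXP <-.
  apply/edge_predP; exists i, j; split=> //.
    by rewrite mnmDE mnm1E eqxx.
  by rewrite mnmDE !mnm1E eqxx addn1.
apply: kpoly_h kp; rewrite -[X in (_ <= X)%N]card_ord; exact: max_card.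
Qed.

End Graphs.

(* [size h = d.+1] says that h has degree d. *)
Theorem theorem1p1 (k : fieldType) (r d : nat) (hr : (1 <= r)%N) (hd : (1 <= d)%N) :
  exists G : sgraph,
    is_reg_quot (edge_ideal k G) r%:Z
    /\ exists2 h : {poly int}, is_h_poly_quot (edge_ideal k G) h & size h = d.+1.
Proof.
suff [h [rh h1 sh]] : exists h, [/\ realizable k r h, h.[1] <> 0 & size h = d.+1].
  by have [G [regG hG]] := realizable_graph rh h1; exists G; split=> //; exists h.
have size1X t : size ((1 + 'X) ^+ t : {poly int}) = t.+1.
  by rewrite addrC -[1]opprK -[- 1]/(- 1%:P) -polyCN size_exp_XsubC.
have nz1X t : (1 + 'X) ^+ t != 0 :> {poly int} by rewrite -size_poly_eq0 size1X.
have eval1X t : ((1 + 'X) ^+ t : {poly int}).[1] = 2 ^+ t.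
  by rewrite horner_exp hornerD hornerX -polyC1 hornerC.
(* If r <= d, one star and r - 1 disjoint edges; otherwise a graph with linear
   h-polynomial and d - 1 disjoint edges. *)
case: r hr => [//|r] _; have [le|lt] := leqP r.+1 d.
  pose b := (d - r.+1)%N.
  have ed : d = (b + r.+1)%N by rewrite /b subnK.
  pose s : {poly int} := 1 + 'X * (1 - 'X) ^+ b.
  have size_s : size s = b.+2.
    have size1mX : size ((1 - 'X) ^+ b : {poly int}) = b.+1.
      by rewrite -opprB exprNn size_Msign -polyC1 size_exp_XsubC.
    have size_t : size ('X * (1 - 'X) ^+ b : {poly int}) = b.+2.
      by rewrite mulrC size_mulX ?size1mX // -size_poly_eq0 size1mX.
    by rewrite /s addrC size_polyDl size_t // size_poly1.
  have rs : realizable k (1 + r) (s * (1 + 'X) ^+ r).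
    by apply: realizable_edges; apply: (realizable_star b (realizable0 k)).
  exists (s * (1 + 'X) ^+ r); split=> //.
    apply/eqP; rewrite hornerM eval1X mulf_neq0 ?expf_neq0 //.
    by rewrite /s !(hornerE, horner_exp) subrr expr0n; case: (b == 0)%N.
  by rewrite size_mul ?size_s ?size1X // -?size_poly_eq0 ?size_s //; lia.
have [N N0 rN] := realizable_linear k (r.+1 - d).
pose s : {poly int} := 1 + 'X *+ N.
have size_s : size s = 2.
  have size_t : size ('X *+ N : {poly int}) = 2.
    rewrite -scaler_nat size_scale ?size_polyX //.
    by rewrite pnatr_eq0 -lt0n.
  by rewrite /s addrC size_polyDl size_t // size_poly1.
exists (s * (1 + 'X) ^+ d.-1); split.
- have -> : r.+1 = ((r.+1 - d).+1 + d.-1)%N by lia.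
  exact: realizable_edges.
- apply/eqP; rewrite hornerM eval1X mulf_neq0 ?expf_neq0 //.
  by rewrite /s hornerD hornerMn hornerX -polyC1 hornerC -mulrS pnatr_eq0.
- by rewrite size_mul ?size_s ?size1X // -?size_poly_eq0 ?size_s //; lia.
Qed.
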